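(* Let $\alpha>1$. The origin $0\in\mathbb{R}^3$ is not a pole of the metric space $(\mathbb{R}^3,d_0^\infty)$. In particular, $(\mathbb{R}^3,d_0^\infty)$ is neither a polar space nor a metric cone of any metric space.
   Context: $d_0^\infty$ is the metric on $\mathbb{R}^3$ induced by the Riemannian metric $\int_0^\infty\frac{dx}{|\zeta-(x^\alpha,0,0)|}\cdot h_0$, with $h_0$ the Euclidean metric, i.e. the completion (identified with $\mathbb{R}^3$) of the Riemannian distance on $\mathbb{R}^3\setminus\{(t,0,0):t\ge0\}$. A ray in a length space $X$ is a continuous curve $\gamma:[0,\infty)\to X$ such that for all $0\le t_0<t_1$ the length of $\gamma|_{[t_0,t_1]}$ equals the distance between $\gamma(t_0)$ and $\gamma(t_1)$. A point $x\in X$ is a pole if for every $\underline{x}\ne x$ there are a ray $\gamma:[0,\infty)\to X$ and $t\ge0$ with $\gamma(0)=x$ and $\gamma(t)=\underline{x}$. Iterated tangent cones of a metric space $Y$ are the pointed spaces obtained by taking a tangent cone $Y_y$ at a point $y\in Y$ (pointed Gromov-Hausdorff limit of rescalings of $(Y,y)$ by factors tending to $\infty$), then tangent cones at points of $Y_y$, and so on. $Y$ is a polar space if the base points of all its iterated tangent cones are poles.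
   Formalization: A ray is additionally required to have infinite length (the distance from γ(0) to γ(t) tends to infinity); otherwise a minimizing segment that stays at its endpoint forever would be a ray and the origin would be a pole. *)

(* Defs.v *)
From HB Require Import structures.
From mathcomp Require Import all_boot all_order all_algebra.
From mathcomp Require Import all_classical all_reals all_analysis.
Set Implicit Arguments.
Unset Strict Implicit.
Unset Printing Implicit Defensive.
Import Order.TTheory GRing.Theory Num.Theory.
Import numFieldNormedType.Exports.
Local Open Scope classical_set_scope.
Local Open Scope ring_scope.

Section metric_notions.
Context {R : realType}.

(* A space is given below by a carrier and a bare distance function, because
   the distance [d0oo] is defined by an infimum and a limit and does not come
   with a bundled proof of the metric axioms.  Spaces that are quantified over
   (tangent cones, cross-sections of cones) are library [metricType]s. *)

Definition curve_length (X : Type) (d : X -> X -> R) (g : R -> X) (a b : R)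
    : \bar R :=
  ereal_sup [set (\sum_(0 <= n < size s)
                    d (g (nth b (a :: s) n)) (g (nth b (a :: s) n.+1)))%:E
            | s in itv_partition a b].

(* The last clause (infinite length) expresses that a ray is a half-infinite
   geodesic.  Without it, a minimizing segment that stays at its endpoint
   forever would be a ray, and every point of a geodesic space a pole. *)
Definition is_ray (X : Type) (d : X -> X -> R) (g : R -> X) : Prop :=
  [/\ forall t, 0 <= t -> d (g t) (g s) @[s --> within `[0, +oo[ (nbhs t)] --> 0,
      forall t0 t1, 0 <= t0 -> t0 < t1 ->
        curve_length d g t0 t1 = (d (g t0) (g t1))%:E
    & d (g 0) (g t) @[t --> +oo] --> +oo].

Definition pole (X : Type) (d : X -> X -> R) (x : X) : Prop :=
  forall y, y <> x ->
    exists (g : R -> X) (t : R), [/\ is_ray d g, 0 <= t, g 0 = x & g t = y].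

Definition complete_space (Z : metricType R) : Prop :=
  forall F : set_system Z, ProperFilter F -> cauchy F -> exists z : Z, F --> z.

(* Burago-Burago-Ivanov, A Course in Metric Geometry, Definition 8.1.1; [f] is
   a map defined on the ball of radius [r] about [p n], extended arbitrarily.
   The limit is required to be complete, so that it is unique. *)
Definition pointed_GH_cvg (X : nat -> Type) (d : forall n, X n -> X n -> R)
    (p : forall n, X n) (Z : metricType R) (z : Z) : Prop :=
  complete_space Z /\
  forall r e : R, 0 < r -> 0 < e -> \forall n \near \oo,
    exists f : X n -> Z,
      [/\ f (p n) = z,
          forall x y, d n (p n) x < r -> d n (p n) y < r ->
            `| mdist (f x) (f y) - d n x y | < e
        & forall w : Z, mdist z w < r - e ->
            exists2 x, d n (p n) x < r & mdist (f x) w < e].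

Definition tangent_cone (Y : Type) (d : Y -> Y -> R) (y : Y)
    (Z : metricType R) (z : Z) : Prop :=
  exists2 l : nat -> R, (forall n, 0 < l n) /\ l @ \oo --> +oo &
    pointed_GH_cvg (fun n (u v : Y) => l n * d u v) (fun=> y) z.

Inductive iterated_tangent_cone (Y : Type) (d : Y -> Y -> R)
    : forall Z : metricType R, Z -> Prop :=
| itc_first (y : Y) (Z : metricType R) (z : Z) :
    tangent_cone d y z -> iterated_tangent_cone d z
| itc_next (W : metricType R) (w : W) (w' : W) (Z : metricType R) (z : Z) :
    iterated_tangent_cone d w -> tangent_cone (@mdist R W) w' z ->
    iterated_tangent_cone d z.

Definition polar_space (Y : Type) (d : Y -> Y -> R) : Prop :=
  forall (Z : metricType R) (z : Z),
    iterated_tangent_cone d z -> pole (@mdist R Z) z.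

(* [0, +oo[ x X with {0} x X collapsed to the apex. *)
Inductive cone (X : Type) : Type :=
| cone_apex
| cone_pt (r : {posnum R}) (x : X).

Definition cone_dist (X : metricType R) (u v : cone X) : R :=
  match u, v with
  | cone_apex, cone_apex => 0
  | cone_apex, cone_pt s _ => s%:num
  | cone_pt r _, cone_apex => r%:num
  | cone_pt r x, cone_pt s y =>
      Num.sqrt (r%:num ^+ 2 + s%:num ^+ 2
                - 2 * r%:num * s%:num * cos (Num.min (mdist x y) pi))
  end.

Definition isometric (X Y : Type) (dX : X -> X -> R) (dY : Y -> Y -> R) : Prop :=
  exists2 f : X -> Y, bijective f & forall u v, dY (f u) (f v) = dX u v.

Definition is_metric_cone (Y : Type) (d : Y -> Y -> R) : Prop :=
  exists X : metricType R, isometric (@cone_dist X) d.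

End metric_notions.

Section d0oo.
Context {R : realType}.
Local Notation E3 := 'rV[R]_3.

(* The norm of the library on row vectors is the sup norm. *)
Definition eucl_norm (v : E3) : R := Num.sqrt (\sum_(i < 3) v 0 i ^+ 2).

Definition axis_pt (t : R) : E3 := t *: delta_mx 0 0.

Definition ray_compl : set E3 := ~` [set axis_pt t | t in `[0, +oo[].

(* Only used on [ray_compl], where the integrand is bounded and, for
   [1 < alpha], the integral is finite. *)
Definition conformal_factor (alpha : R) (z : E3) : R :=
  \int[lebesgue_measure]_(x in `[0, +oo[)
    (eucl_norm (z - axis_pt (x `^ alpha)))^-1.

(* On each piece, [c] is the restriction of a C^1 map defined on all of [R];
   on closed pieces this is the same as being C^1 up to the endpoints. *)
Definition piecewise_C1 (c : R -> E3) : Prop :=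
  exists2 s : seq R, itv_partition 0 1 s &
    forall i, (i < size s)%N -> exists g : R -> E3,
      [/\ forall t, derivable g t 1,
          continuous (derive1 g)
        & forall t, t \in `[nth 1 (0 :: s) i, nth 1 (0 :: s) i.+1] -> c t = g t].

Definition riem_length (alpha : R) (c : R -> E3) : R :=
  \int[lebesgue_measure]_(t in `[0, 1])
    (Num.sqrt (conformal_factor alpha (c t)) * eucl_norm (derive1 c t)).

Definition riem_dist (alpha : R) (p q : E3) : R :=
  inf [set riem_length alpha c | c in
        [set c : R -> E3 | [/\ piecewise_C1 c,
           forall t, t \in `[0, 1] -> ray_compl (c t), c 0 = p & c 1 = q]]].

(* The completion of [(ray_compl, riem_dist alpha)], transported to R^3: a
   point of R^3 stands for the class of the sequences of [ray_compl] that tend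
   to it in the Euclidean topology, so its distance to another one is the limit
   of the Riemannian distances of approximating points. *)
Definition d0oo (alpha : R) (p q : E3) : R :=
  lim (riem_dist alpha w.1 w.2
       @[w --> within (ray_compl `*` ray_compl) (nbhs (p, q))]).

End d0oo.

(* Main.v *)
From HB Require Import structures.
Require Import Defs.
From mathcomp Require Import all_boot all_order all_algebra.
From mathcomp Require Import all_classical all_reals all_analysis.
From mathcomp Require Import measurable_realfun.
From mathcomp Require Import ring lra.
Import Order.TTheory GRing.Theory Num.Theory.
Import numFieldNormedType.Exports.
Local Open Scope classical_set_scope.
Local Open Scope ring_scope.
Set Implicit Arguments.
Unset Strict Implicit.
Unset Printing Implicit Defensive.

(** The conformal factor is the potential of a line source on the positive axis.
    Three of its features carry the whole argument.

    - It is invariant under rotations about the axis and homogeneous under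
      dilations ([conformal_factorZ]).  Hence rotations are isometries of the
      completed distance [d], and the dilation by [l] multiplies [d] by
      [l `^ dilation_exp], with an exponent at most [1] ([d0ooZ],
      [d0oo_reflection]).
    - Next to the axis it is unbounded ([conformal_factor_blowup]), so that near
      the point [axis_pt 1] the distance [d] dominates any prescribed multiple of
      the Euclidean one ([d0oo_steep]).
    - On bounded sets it grows at most like the inverse distance to the axis
      ([conformal_factor_le]), and the square root of that is integrable along a
      segment leaving the axis.  So the Riemannian distance extends continuously
      to the whole space ([riem_dist_small], [riem_dist_cvg]).

    Suppose that a ray from a point close to the origin passes through
    [axis_pt 1].  Its angle with the axis vanishes there and is continuous, so by
    the intermediate value theorem the ray takes some angle both at a point [u]
    before and at a point [v] after [axis_pt 1].  Up to a rotation [v] is a multiple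
    of [u], whence the distances of [u] and [v] to the origin differ by at most a
    fixed multiple of the Euclidean distance of [u] and [v].  Since the curve is
    minimizing, they also differ by about [d u v], which is a much larger multiple
    of that Euclidean distance: a contradiction ([no_extension]).  By dilation, any
    point whatsoever can be moved close to the origin, so that no point of the
    space is a pole ([no_pole]).

    The other two claims follow.  The dilations exhibit the space as a tangent cone
    of itself at the origin, so it is not polar; this needs that [d] is a complete
    metric, which rests on the lower bounds [d0oo_ge_eucl] and [d0oo_growth].  And
    the apex of a metric cone is a pole ([cone_apex_pole]).

    Lengths are never computed as integrals: each curve has an arc-length function
    whose derivative is the speed except at finitely many parameters
    ([admissible_arc_length]), and two such functions are compared through their
    derivatives ([derive_le_exc]). *)

Lemma is_derive1_continuous (R : realType) (V : normedModType R) (f : R -> V)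
    (x : R) (d : V) : is_derive x 1 f d -> {for x, continuous f}.
Proof. by move=> fd; exact/differentiable_continuous/derivable1_diffP. Qed.

(** * Euclidean geometry of the rotation axis *)

Section euclidean.
Context {R : realType}.
Local Notation E3 := 'rV[R]_3.
Implicit Types (u v w p q z : E3) (t : R).

Definition dot u v : R := \sum_(i < 3) u 0 i * v 0 i.

Lemma dotC u v : dot u v = dot v u.
Proof. by apply: eq_bigr => i _; rewrite mulrC. Qed.

Lemma dotDl u v w : dot (u + v) w = dot u w + dot v w.
Proof. by rewrite -big_split; apply: eq_bigr => i _; rewrite mxE mulrDl. Qed.

Lemma dotZl k u v : dot (k *: u) v = k * dot u v.
Proof. by rewrite mulr_sumr; apply: eq_bigr => i _; rewrite mxE mulrA. Qed.

Lemma dotDr u v w : dot w (u + v) = dot w u + dot w v.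
Proof. by rewrite dotC dotDl ![dot _ w]dotC. Qed.

Lemma dotZr k u v : dot v (k *: u) = k * dot v u.
Proof. by rewrite dotC dotZl dotC. Qed.

Lemma dotNl u v : dot (- u) v = - dot u v.
Proof. by rewrite -scaleN1r dotZl mulN1r. Qed.

Lemma dotNr u v : dot v (- u) = - dot v u.
Proof. by rewrite dotC dotNl dotC. Qed.

Lemma dotBl u v w : dot (u - v) w = dot u w - dot v w.
Proof. by rewrite dotDl dotNl. Qed.

Lemma dotBr u v w : dot w (u - v) = dot w u - dot w v.
Proof. by rewrite dotDr dotNr. Qed.

Definition dotE := (dotBl, dotBr, dotDl, dotDr, dotNl, dotNr, dotZl, dotZr).

Lemma dot_ge0 u : 0 <= dot u u.
Proof. by apply: sumr_ge0 => i _; rewrite -expr2 sqr_ge0. Qed.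

Lemma eucl_norm_ge0 u : 0 <= eucl_norm u.
Proof. exact: sqrtr_ge0. Qed.

Lemma sqr_eucl_norm u : eucl_norm u ^+ 2 = dot u u.
Proof. by rewrite sqr_sqrtr//; apply: sumr_ge0 => i _; rewrite sqr_ge0. Qed.

Lemma eucl_normE u : eucl_norm u = Num.sqrt (dot u u).
Proof. by rewrite -sqr_eucl_norm sqrtr_sqr ger0_norm ?eucl_norm_ge0. Qed.

Lemma eucl_norm0 : eucl_norm (0 : E3) = 0.
Proof.
by rewrite eucl_normE /dot big1 ?sqrtr0// => i _; rewrite mxE mul0r.
Qed.

Lemma eucl_norm_eq0 u : eucl_norm u = 0 -> u = 0.
Proof.
move/(congr1 (fun x => x ^+ 2)); rewrite sqr_eucl_norm expr0n/= => /eqP.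
rewrite /dot psumr_eq0; last by move=> i _; rewrite -expr2 sqr_ge0.
move=> /allP u0; apply/rowP => i; rewrite mxE.
have := u0 i (mem_index_enum _); rewrite implyTb mulf_eq0 orbb.
by move/eqP.
Qed.

Lemma eucl_normZ k u : eucl_norm (k *: u) = `|k| * eucl_norm u.
Proof.
by rewrite !eucl_normE dotZl dotZr mulrA -expr2 sqrtrM ?sqr_ge0// sqrtr_sqr.
Qed.

Lemma eucl_normN u : eucl_norm (- u) = eucl_norm u.
Proof. by rewrite -scaleN1r eucl_normZ normrN1 mul1r. Qed.

Lemma eucl_distC u v : eucl_norm (u - v) = eucl_norm (v - u).
Proof. by rewrite -eucl_normN opprB. Qed.

Lemma cauchy_schwarz u v : dot u v <= eucl_norm u * eucl_norm v.
Proof.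
have [v0|v0] := eqVneq (eucl_norm v) 0.
  rewrite (eucl_norm_eq0 v0) eucl_norm0 mulr0.
  by rewrite -[0 in leLHS](scale0r u) dotZr mul0r.
have [uv|uv] := leP (dot u v) 0.
  by rewrite (le_trans uv)// mulr_ge0 ?eucl_norm_ge0.
rewrite -(@ler_pXn2r _ 2)// ?nnegrE ?mulr_ge0 ?eucl_norm_ge0 ?(ltW uv)//.
rewrite exprMn !sqr_eucl_norm.
have vv : 0 < dot v v by rewrite -sqr_eucl_norm exprn_gt0// lt_def v0 eucl_norm_ge0.
have := dot_ge0 (dot v v *: u - dot u v *: v).
have -> : dot (dot v v *: u - dot u v *: v) (dot v v *: u - dot u v *: v) =
  dot v v * (dot u u * dot v v - dot u v ^+ 2).
  by rewrite !dotE (dotC v u); ring.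
by rewrite (pmulr_rge0 _ vv) subr_ge0.
Qed.

Lemma eucl_normD u v : eucl_norm (u + v) <= eucl_norm u + eucl_norm v.
Proof.
rewrite -(@ler_pXn2r _ 2)// ?nnegrE ?addr_ge0 ?eucl_norm_ge0//.
rewrite sqrrD !sqr_eucl_norm !dotE (dotC v u).
have := cauchy_schwarz u v; lra.
Qed.

Lemma eucl_distD w u v :
  eucl_norm (u - v) <= eucl_norm (u - w) + eucl_norm (w - v).
Proof. by have := eucl_normD (u - w) (w - v); rewrite addrA subrK. Qed.

Lemma eucl_norm_subr u v : eucl_norm u <= eucl_norm v + eucl_norm (u - v).
Proof. by have := eucl_normD v (u - v); rewrite addrC subrK. Qed.

Lemma coord_le_eucl_norm u i : `|u 0 i| <= eucl_norm u.
Proof.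
rewrite -(@ler_pXn2r _ 2)// ?nnegrE ?eucl_norm_ge0// sqr_eucl_norm real_normK ?num_real//.
rewrite /dot (bigD1 i)//= -expr2 lerDl sumr_ge0// => j _.
by rewrite -expr2 sqr_ge0.
Qed.

(** [`|u|] is the sup norm, so its comparison with [eucl_norm] is what identifies the
    topology of ['rV_3] with the Euclidean one. *)
Lemma norm_le_eucl_norm u : `|u| <= eucl_norm u.
Proof.
have [->|u0] := eqVneq u 0; first by rewrite normr0 eucl_norm_ge0.
have [|i] := @mx_norm_neq0 _ _ _ u; first by rewrite -[mx_norm u]/`|u| normr_eq0.
by rewrite -[mx_norm u]/`|u| => ->; rewrite (ord1 i.1) coord_le_eucl_norm.
Qed.

Lemma eucl_norm_le_norm u : eucl_norm u <= 3 * `|u|.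
Proof.
have u0 : 0 <= `|u| by [].
rewrite -(@ler_pXn2r _ 2)// ?nnegrE ?mulr_ge0 ?eucl_norm_ge0// sqr_eucl_norm.
apply: (@le_trans _ _ (\sum_(i < 3) `|u| ^+ 2)).
  apply: ler_sum => i _; rewrite -expr2 -[leLHS]real_normK ?num_real//.
  rewrite ler_pXn2r// ?nnegrE// -[leRHS]/(mx_norm u) mx_normrE.
  by apply/bigmax_geP; right; exists (ord0, i).
by rewrite sumr_const card_ord exprMn -mulr_natl; have := sqr_ge0 `|u|; nra.
Qed.

Lemma nbhs_euclP p (P : set E3) :
  nbhs p P <-> exists2 e, 0 < e & forall q, eucl_norm (q - p) < e -> P q.
Proof.
split=> [|[e e0 eP]]; first rewrite -nbhs_nbhs_norm => -[e /= e0 eP].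
  exists e => // q qpe; apply: eP; rewrite /ball_/= -normrN opprB.
  exact: le_lt_trans (norm_le_eucl_norm _) qpe.
rewrite -nbhs_nbhs_norm; exists (e / 3) => /=; first by rewrite divr_gt0.
move=> q; rewrite /ball_/= ltr_pdivlMr// mulrC => pq; apply: eP.
by rewrite eucl_distC; exact: le_lt_trans (eucl_norm_le_norm _) pq.
Qed.

Lemma continuous_eucl_norm : continuous (@eucl_norm R).
Proof.
move=> p; apply/(@cvgrPdist_lt _ _ _ (nbhs p)) => e e0.
apply/nbhs_euclP; exists e => // q qp.
rewrite ltr_norml; have := eucl_norm_subr p q; have := eucl_norm_subr q p.
by rewrite (eucl_distC p q); lra.
Qed.

(** The squared distance to the whole line that carries the half-axis. *)
Definition axial_sq u : R := dot u u - u 0 0 ^+ 2.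

Lemma axial_sqE u : axial_sq u = u 0 1 ^+ 2 + u 0 2%:R ^+ 2.
Proof.
rewrite /axial_sq /dot !big_ord_recl big_ord0 -!expr2 addr0 addrAC.
rewrite subrr add0r.
by congr (u 0 _ ^+ 2 + u 0 _ ^+ 2); apply/val_inj.
Qed.

Lemma axial_sq_ge0 u : 0 <= axial_sq u.
Proof. by rewrite axial_sqE addr_ge0 ?sqr_ge0. Qed.

Lemma axis_ptE t i : (axis_pt t : E3) 0 i = t * (i == 0)%:R.
Proof. by rewrite !mxE eqxx. Qed.

Lemma dot_axis t u : dot (axis_pt t) u = t * u 0 0.
Proof.
rewrite /dot big_ord_recl big1 ?addr0; first by rewrite axis_ptE/= mulr1.
by move=> i _; rewrite axis_ptE mulr0 mul0r.
Qed.

Lemma sqr_dist_axis z t :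
  eucl_norm (z - axis_pt t) ^+ 2 = (z 0 0 - t) ^+ 2 + axial_sq z.
Proof.
rewrite sqr_eucl_norm dotBl !dotBr (dotC z (axis_pt t)) !dot_axis axis_ptE /= /axial_sq; ring.
Qed.

Lemma eucl_norm_axis t : eucl_norm (axis_pt t : E3) = `|t|.
Proof. by rewrite eucl_normE dot_axis axis_ptE mulr1 -expr2 sqrtr_sqr. Qed.

Lemma axis_ptZ k t : axis_pt (k * t) = k *: axis_pt t :> E3.
Proof. by rewrite /axis_pt scalerA. Qed.

Lemma axis_ptB s t : axis_pt (s - t) = axis_pt s - axis_pt t :> E3.
Proof. by rewrite /axis_pt scalerBl. Qed.

Lemma dist_axis_pos z t : ray_compl z -> 0 <= t ->
  0 < eucl_norm (z - axis_pt t).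
Proof.
move=> zr t0; rewrite lt_def eucl_norm_ge0 andbT; apply/eqP => /eucl_norm_eq0.
move/eqP; rewrite subr_eq0 => /eqP zE; apply: zr; exists t; last by rewrite zE.
by rewrite /= in_itv/= t0.
Qed.

Lemma dist_axis_ray_compl z :
  (forall t, 0 <= t -> 0 < eucl_norm (z - axis_pt t)) -> ray_compl z.
Proof.
move=> zP [t /=]; rewrite in_itv/= andbT => t0 tz.
by have := zP t t0; rewrite tz subrr eucl_norm0 ltxx.
Qed.

Lemma axial_ray_compl z : 0 < axial_sq z -> ray_compl z.
Proof.
move=> z0; apply: dist_axis_ray_compl => t _.
rewrite -(@ltr_pXn2r _ 2)// ?nnegrE ?eucl_norm_ge0// expr0n sqr_dist_axis/=.
by rewrite ltr_wpDl ?sqr_ge0.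
Qed.

(** The distance to the half-axis is attained at the origin when [z] lies on the
    negative axis, and is at least the distance to the line otherwise. *)
Lemma ray_compl_dist z : ray_compl z ->
  exists2 k, 0 < k <= 1 & forall t, 0 <= t -> k <= eucl_norm (z - axis_pt t).
Proof.
move=> zr; suff [k k0 kP] : exists2 k, 0 < k &
    forall t, 0 <= t -> k <= eucl_norm (z - axis_pt t).
  exists (Num.min k 1); first by rewrite lt_min k0 ltr01 ge_min lexx orbT.
  by move=> t t0; rewrite ge_min kP.
have := axial_sq_ge0 z; rewrite le_eqVlt => /predU1P[z0|z0]; last first.
  exists (Num.sqrt (axial_sq z)); first by rewrite sqrtr_gt0.
  move=> t t0; rewrite -(@ler_pXn2r _ 2)// ?nnegrE ?eucl_norm_ge0// ?sqrtr_ge0//.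
  by rewrite sqr_sqrtr ?axial_sq_ge0// sqr_dist_axis lerDr sqr_ge0.
have zN : z 0 0 < 0.
  rewrite ltNge; apply/negP => zP.
  have := dist_axis_pos zr zP; rewrite -(@ltr_pXn2r _ 2)// ?nnegrE ?eucl_norm_ge0//.
  by rewrite sqr_dist_axis -z0 subrr expr0n /= addr0 ltxx.
exists (- z 0 0); first by rewrite oppr_gt0.
move=> t t0; rewrite -(@ler_pXn2r _ 2)// ?nnegrE ?eucl_norm_ge0// ?oppr_ge0 ?(ltW zN)//.
rewrite sqr_dist_axis -z0 addr0; nra.
Qed.

Lemma ray_complZ k z : 0 < k -> ray_compl z -> ray_compl (k *: z).
Proof.
move=> k0 zr; apply: dist_axis_ray_compl => t t0.
have -> : t = k * (t / k) by rewrite mulrC divfK// gt_eqF.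
rewrite axis_ptZ -scalerBr eucl_normZ mulr_gt0 ?normr_gt0 ?gt_eqF//.
by rewrite dist_axis_pos// divr_ge0// ltW.
Qed.

End euclidean.

(** * The conformal factor *)

Section conformal.
Context {R : realType} (alpha : R) (alpha_gt1 : 1 < alpha).
Local Notation E3 := 'rV[R]_3.
Local Notation mu := (@lebesgue_measure R).
Local Notation f := (@conformal_factor R alpha).
Implicit Types (z : E3) (x : R).

Let alpha_gt0 : 0 < alpha. Proof. exact: lt_trans alpha_gt1. Qed.

Definition kernel z x : R := (eucl_norm (z - axis_pt (x `^ alpha)))^-1.

Lemma kernel_ge0 z x : 0 <= kernel z x.
Proof. by rewrite invr_ge0 eucl_norm_ge0. Qed.

Lemma continuous_dist_axis z : continuous (fun s => eucl_norm (z - axis_pt s)).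
Proof.
move=> s; apply/(@cvgrPdist_lt _ _ _ (nbhs s)) => e e0.
near=> t.
have st : eucl_norm (axis_pt s - axis_pt t : E3) < e.
  rewrite -axis_ptB eucl_norm_axis.
  by near: t; apply: cvgr_dist_lt e0; exact: cvg_id.
have E a b : z - a - (z - b) = b - a by apply/rowP => i; rewrite !mxE; ring.
have := eucl_norm_subr (z - axis_pt s) (z - axis_pt t).
have := eucl_norm_subr (z - axis_pt t) (z - axis_pt s).
rewrite !E (eucl_distC (axis_pt t)) ltr_norml; lra.
Unshelve. all: by end_near. Qed.

Lemma powR_cvg_within x : 0 <= x ->
  t `^ alpha @[t --> within `[0, +oo[ (nbhs x)] --> x `^ alpha.
Proof.
move=> x0.
have : {within `[0, +oo[, continuous (fun t => t `^ alpha)}.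
  apply/continuous_within_itvcyP; split; last first.
    by rewrite powR0 ?gt_eqF//; exact: powR_cvg0.
  by move=> y y0; exact/differentiable_continuous/derivable1_diffP/derivable_powR.
move=> /subspace_continuousP cP; refine (cP x _).
by rewrite /= in_itv/= x0.
Qed.

Lemma continuous_kernel z : ray_compl z ->
  {within `[0, +oo[, continuous (kernel z)}.
Proof.
move=> zr; apply/subspace_continuousP => x /=; rewrite in_itv/= andbT => x0.
apply: cvgV; first by rewrite gt_eqF// dist_axis_pos// powR_ge0.
exact: (cvg_comp _ _ (powR_cvg_within x0) (@continuous_dist_axis z _)).
Qed.

Lemma measurable_kernel z : ray_compl z -> measurable_fun `[(0 : R), +oo[ (kernel z).
Proof.
move=> zr; apply: subspace_continuous_measurable_fun => //.
exact: continuous_kernel.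
Qed.

(** A single integrable function of [x], up to a factor, dominates all kernels (see
    [kernel_le]). *)
Lemma integral_dominator :
  (\int[mu]_(x in `[0%R, +oo[) ((1 + x) `^ (- alpha))%:E = (alpha - 1)^-1%:E)%E.
Proof.
pose F (x : R) : R := (1 - alpha)^-1 * (1 + x) `^ (1 - alpha).
have a1 : 1 - alpha != 0 by rewrite subr_eq0 lt_eqF.
have dpow (b x : R) : 0 <= x ->
    is_derive x 1 (fun x => (1 + x) `^ b) (b * (1 + x) `^ (b - 1)).
  move=> x0; have x1 : 0 < 1 + x by rewrite ltr_wpDr.
  have d1 : is_derive x 1 (fun x : R => 1 + x) 1.
    by rewrite -[X in is_derive _ _ _ X]add0r; exact: is_deriveD.
  by have := is_derive1_comp (is_derive1_powR b x1) d1; rewrite mulr1.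
have dg (x : R) (x0 : 0 <= x) : is_derive x 1 (fun x => (1 + x) `^ (- alpha)) _ :=
  dpow (- alpha) _ x0.
have dF x : 0 <= x -> is_derive x 1 F ((1 + x) `^ (- alpha)).
  move=> x0.
  have := is_deriveZ (1 - alpha)^-1 (dpow (1 - alpha) _ x0).
  rewrite [X in is_derive _ _ _ X -> _](_ : _ = (1 + x) `^ (- alpha)) //.
  by rewrite /GRing.scale/= mulrA mulVf// mul1r -addrAC subrr add0r.
have F0 : (1 + x) `^ (1 - alpha) @[x --> +oo] --> 0.
  apply/cvgrPdist_lt => e e0; near=> x.
  have x1 : 0 < 1 + x by rewrite addr_gt0.
  rewrite sub0r normrN ger0_norm ?powR_ge0//.
  have a1' : 0 < alpha - 1 by rewrite subr_gt0.
  rewrite -[1 - alpha]opprB powRN -[e]invrK ltf_pV2 ?posrE ?invr_gt0 ?powR_gt0//.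
  have -> : e^-1 = (e^-1 `^ (alpha - 1)^-1) `^ (alpha - 1).
    by rewrite -powRrM mulVf ?gt_eqF// powRr1// invr_ge0 ltW.
  rewrite gt0_ltr_powR ?nnegrE ?powR_ge0//; first exact: ltW.
  by rewrite -ltrBlDl; near: x; exact: nbhs_pinfty_gt.
rewrite (@ge0_continuous_FTC2y _ _ F 0 0).
- by rewrite /F addr0 powR1 mulr1 sub0e -EFinN -invrN opprB.
- by move=> x _; exact: powR_ge0.
- apply/continuous_within_itvcyP; split; last first.
    exact/cvg_at_right_filter/(is_derive1_continuous (dg _ (lexx 0))).
  move=> x; rewrite in_itv/= andbT => /ltW x0.
  exact: is_derive1_continuous (dg _ x0).
- by rewrite -[X in _ --> X](mulr0 (1 - alpha)^-1); exact: cvgMr.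
- by move=> x x0; apply: (@ex_derive _ _ _ _ _ _ _ (dF _ (ltW x0))).
- exact/cvg_at_right_filter/(is_derive1_continuous (dF _ (lexx 0))).
- by move=> x; rewrite in_itv/= andbT => /ltW/dF[_ dFx]; rewrite derive1E.
Unshelve. all: by end_near. Qed.

(** Near the origin of the half-line the distance is at least [k]; far out it is
    comparable with [x `^ alpha].  The factor interpolates between the two regimes,
    with the singular [1 / k] kept explicit. *)
Lemma kernel_le N z k x : 0 < k <= 1 ->
  (forall t, 0 <= t -> k <= eucl_norm (z - axis_pt t)) ->
  eucl_norm z <= N -> 0 <= x ->
  kernel z x <= 2 `^ alpha * (N + 2) / k * (1 + x) `^ (- alpha).
Proof.
move=> /andP[k0 k1] kz zN x0; have x1 : 0 < 1 + x by rewrite ltr_wpDr.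
have N0 : 0 <= N by apply: le_trans zN; exact: eucl_norm_ge0.
have := kz _ (powR_ge0 x alpha); rewrite /kernel.
have : x `^ alpha <= N + eucl_norm (z - axis_pt (x `^ alpha)).
  have := eucl_norm_subr (axis_pt (x `^ alpha)) z.
  by rewrite eucl_norm_axis ger0_norm ?powR_ge0// eucl_distC; lra.
set D := eucl_norm _ => xD kD.
have D0 : 0 < D by exact: lt_le_trans kD.
rewrite powRN ler_pdivlMr ?powR_gt0// [_^-1 * _]mulrC ler_pdivrMr//.
rewrite mulrAC ler_pdivlMr//.
have : (1 + x) `^ alpha <= 2 `^ alpha * (1 + x `^ alpha).
  have p0 := powR_ge0 2 alpha.
  have [x1'|x1'] := leP x 1.
    apply: (@le_trans _ _ (2 `^ alpha)); last first.
      by rewrite ler_peMr// lerDl powR_ge0.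
    rewrite ge0_ler_powR ?nnegrE ?(ltW alpha_gt0) ?(ltW x1)//; lra.
  apply: (@le_trans _ _ (2 `^ alpha * x `^ alpha)); last first.
    by rewrite ler_wpM2l// lerDr.
  rewrite -powRM// ge0_ler_powR ?nnegrE ?(ltW alpha_gt0) ?(ltW x1) ?mulr_ge0//; lra.
move=> xP; apply: (@le_trans _ _ (2 `^ alpha * (1 + x `^ alpha) * k)).
  by rewrite ler_wpM2r// ltW.
rewrite -!mulrA ler_wpM2l ?powR_ge0//.
move: xD kD N0 (powR_ge0 x alpha); nra.
Qed.

Lemma integrable_dominator (C : R) :
  mu.-integrable `[0, +oo[ (fun x => (C * (1 + x) `^ (- alpha))%:E).
Proof.
apply: (@integrableZl _ _ _ mu `[0, +oo[ _ C (fun x => ((1 + x) `^ (- alpha))%:E)) => //.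
apply/integrableP; split.
  apply/measurable_EFinP; apply: (@measurableT_comp _ _ _ _ _ _ (fun x => x `^ (- alpha))).
    exact: measurable_powR.
  exact: measurable_funD.
under eq_integral do rewrite gee0_abs ?lee_fin ?powR_ge0//.
by rewrite integral_dominator ltry.
Qed.

Lemma integrable_kernel z : ray_compl z ->
  mu.-integrable `[0, +oo[ (fun x => (kernel z x)%:E).
Proof.
move=> zr; have [k k01 kz] := ray_compl_dist zr.
apply: (le_integrable _ _ _
  (integrable_dominator (2 `^ alpha * (eucl_norm z + 2) / k))) => //.
  by apply/measurable_EFinP; exact: measurable_kernel.
move=> x /=; rewrite in_itv/= andbT => x0; rewrite lee_fin.
rewrite ger0_norm ?kernel_ge0//; apply: (le_trans _ (ler_norm _)).
exact: kernel_le.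
Qed.

Lemma conformal_factor_le N z k : 0 < k <= 1 ->
  (forall t, 0 <= t -> k <= eucl_norm (z - axis_pt t)) ->
  eucl_norm z <= N ->
  f z <= 2 `^ alpha * (N + 2) / (alpha - 1) / k.
Proof.
move=> k01 kz zN; have k0 : 0 < k by case/andP: k01.
apply: (@le_trans _ _
    (\int[mu]_(x in `[0, +oo[) (2 `^ alpha * (N + 2) / k * (1 + x) `^ (- alpha)))).
  apply: le_Rintegral => //.
  - apply: integrable_kernel; apply: dist_axis_ray_compl => t t0.
    exact: lt_le_trans (kz _ t0).
  - exact: integrable_dominator.
  - by move=> x /=; rewrite in_itv/= andbT => x0; exact: kernel_le.
rewrite RintegralZl//; last first.
  have -> : EFin \o (fun x => (1 + x) `^ (- alpha)) =
      (fun x => (1 * (1 + x) `^ (- alpha))%:E).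
    by apply/funext => x /=; rewrite mul1r.
  exact: integrable_dominator.
by rewrite /Rintegral integral_dominator/= mulrAC.
Qed.

Lemma conformal_factor_ge0 z : 0 <= f z.
Proof. by apply: Rintegral_ge0 => x _; rewrite kernel_ge0. Qed.

(** Lower bounds come from the part of the half-line that is close to [z]. *)
Lemma conformal_factor_ge_int z (a b : R) (g : R -> R) : ray_compl z ->
  0 <= a -> mu.-integrable `[a, b] (EFin \o g) ->
  {in `[a, b], forall x, g x <= kernel z x} ->
  \int[mu]_(x in `[a, b]) g x <= f z.
Proof.
move=> zr a0 ig gz.
have ab0 : `[a, b]%classic `<=` `[0, +oo[%classic.
  by move=> x /=; rewrite !in_itv/= andbT => /andP[ax _]; exact: le_trans ax.
have ik := integrable_kernel zr.
have ik' : mu.-integrable `[a, b] (fun x => (kernel z x)%:E).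
  exact: integrableS ik.
apply: (@le_trans _ _ (\int[mu]_(x in `[a, b]) kernel z x)).
  by apply: le_Rintegral => // x xab; exact: gz.
rewrite /conformal_factor /Rintegral fine_le ?integrable_fin_num//.
apply: ge0_subset_integral => //; last first.
  by move=> x _; rewrite lee_fin kernel_ge0.
by apply/measurable_EFinP; exact: measurable_kernel.
Qed.

(** The sources at parameters in [0, 1] lie in the unit ball. *)
Lemma conformal_factor_ge N z : ray_compl z -> eucl_norm z <= N ->
  (N + 1)^-1 <= f z.
Proof.
move=> zr zN.
have N0 : 0 <= N by apply: le_trans zN; exact: eucl_norm_ge0.
have -> : (N + 1)^-1 = \int[mu]_(x in `[0, 1]) (fun=> (N + 1)^-1) x.
  rewrite Rintegral_cst//=.
  have := @lebesgue_measure_itv R `[0, 1].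
  by rewrite /= lte_fin ltr01 sube0 => ->; rewrite mulr1.
apply: conformal_factor_ge_int => //.
  by apply: continuous_compact_integrable;
    [exact: segment_compact|exact: continuous_subspaceT (@cst_continuous _ _ _)].
move=> x; rewrite in_itv/= => /andP[x0 x1].
rewrite lef_pV2 ?posrE ?dist_axis_pos ?powR_ge0 ?ltr_wpDl//.
apply: le_trans (eucl_normD _ _) _; rewrite eucl_normN eucl_norm_axis.
rewrite ger0_norm ?powR_ge0// lerD//.
have -> : 1 = 1 `^ alpha :> R by rewrite powR1.
by rewrite ge0_ler_powR ?nnegrE// ltW.
Qed.

(** A bound on the speed at which the source moves away from [axis_pt 1]. *)
Lemma powR_sub1_le x : 1 <= x <= 2 ->
  x `^ alpha - 1 <= alpha * expR alpha * (x - 1).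
Proof.
move=> /andP[x1 x2]; have x0 : 0 < x by rewrite (lt_le_trans _ x1).
set y := alpha * (x - 1).
have y0 : 0 <= y by rewrite mulr_ge0 ?subr_ge0// ltW.
have xy : x `^ alpha <= expR y.
  rewrite /powR gt_eqF// ler_expR ler_wpM2l ?(ltW alpha_gt0)//.
  by have := @le_ln1Dx _ (x - 1); rewrite (addrC 1) subrK; apply; lra.
have : expR y - 1 <= y * expR y.
  have := expR_ge1Dx (- y); rewrite expRN.
  rewrite -[leRHS]mul1r ler_pdivlMr ?expR_gt0//; lra.
have : y * expR y <= y * expR alpha.
  by rewrite ler_wpM2l// ler_expR /y ger_pMr//; lra.
have -> : alpha * expR alpha * (x - 1) = y * expR alpha by rewrite /y; ring.
lra.
Qed.

(** The source passes [axis_pt 1] with bounded speed, so the potential there is at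
    least the integral of [(e + C * (x - 1))^-1] for [x] in [1, 2], which grows like
    [- ln e]. *)
Lemma conformal_factor_blowup (K : R) : exists2 e, 0 < e &
  forall z, ray_compl z -> eucl_norm (z - axis_pt 1) <= e -> K <= f z.
Proof.
pose C := alpha * expR alpha.
have C0 : 0 < C by rewrite mulr_gt0 ?expR_gt0.
(* this e makes C^-1 * ln (C / e) equal to K *)
pose e := C * expR (- (K * C)).
have e0 : 0 < e by rewrite mulr_gt0 ?expR_gt0.
exists e => // z zr ze.
pose G x := C^-1 * ln (e + C * (x - 1)).
pose g x := (e + C * (x - 1))^-1.
have pos x : 1 <= x -> 0 < e + C * (x - 1).
  by move=> x1; rewrite ltr_wpDr// mulr_ge0 ?subr_ge0// ltW.
have d1 x : is_derive x 1 (fun x => e + C * (x - 1)) C.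
  have d : is_derive x 1 (fun x : R => x - 1) 1.
    by rewrite -[X in is_derive _ _ _ X]addr0; exact: is_deriveD.
  have := is_deriveD (is_derive_cst e x 1) (is_deriveZ C d).
  by rewrite add0r /GRing.scale/= mulr1.
have dG x : 1 <= x -> is_derive x 1 G (g x).
  move=> x1; have d2 := @is_derive1_comp R (@ln R) (fun x => e + C * (x - 1)) x _ _
    (is_derive1_ln (pos _ x1)) (d1 x).
  have := is_deriveZ C^-1 d2.
  by rewrite /GRing.scale/= mulrCA mulVf ?gt_eqF// mulr1.
have cg x : 1 <= x -> {for x, continuous g}.
  move=> x1; apply: cvgV; first by rewrite gt_eqF// pos.
  exact: is_derive1_continuous (d1 x).
have cgw : {within `[1, 2], continuous g}.
  apply: continuous_in_subspaceT => x /[!inE]/=; rewrite in_itv/= => /andP[x1 _].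
  exact: cg.
apply: le_trans (conformal_factor_ge_int (a := 1) (b := 2) (g := g) zr ler01 _ _).
- have l12 : 1 < 2 :> R by lra.
  rewrite /Rintegral (continuous_FTC2 (F := G) l12 cgw).
  + rewrite /= /G subrr mulr0 addr0 -mulrBr ler_pdivlMl//.
    rewrite {2}/e lnM ?posrE ?expR_gt0// expRK.
    have : ln C <= ln (e + C * (2 - 1)) by rewrite ler_ln ?posrE//; lra.
    by rewrite mulrC; lra.
  + split.
    * by move=> x; rewrite in_itv/= => /andP[/ltW x1 _]; have [] := dG _ x1.
    * exact/cvg_at_right_filter/(is_derive1_continuous (dG _ (lexx 1))).
    * by apply/cvg_at_left_filter/(is_derive1_continuous (dG 2 _)); lra.
  + move=> x; rewrite in_itv/= => /andP[/ltW x1 _].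
    by rewrite derive1E; have [] := dG _ x1.
- by apply: continuous_compact_integrable => //; exact: segment_compact.
- move=> x; rewrite in_itv/= => x12; have x1 : 1 <= x by case/andP: x12.
  rewrite lef_pV2 ?posrE ?dist_axis_pos ?powR_ge0 ?pos//.
  apply: le_trans (eucl_distD (axis_pt 1) _ _) _.
  rewrite lerD// -axis_ptB eucl_norm_axis distrC ger0_norm; last first.
    by rewrite subr_ge0; have := ler_powR x1 (ltW alpha_gt0); rewrite powRr0.
  exact: powR_sub1_le.
Qed.

(** Moving [z] by a fraction [e] of its distance to the half-axis changes every
    distance to a source point by a factor at least [1 - e]; this is the continuity
    of the conformal factor in a quantitative form. *)
Lemma conformal_factor_near z z' k e : 0 < k -> 0 <= e < 1 ->
  (forall t, 0 <= t -> k <= eucl_norm (z - axis_pt t)) ->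
  eucl_norm (z - z') <= e * k ->
  ray_compl z' /\ (1 - e) * f z' <= f z.
Proof.
move=> k0 /andP[e0 e1] kz zz'.
have D t : 0 <= t ->
    (1 - e) * eucl_norm (z - axis_pt t) <= eucl_norm (z' - axis_pt t).
  move=> t0; have := kz _ t0; have := eucl_distD z' z (axis_pt t); nra.
have zr : ray_compl z.
  by apply: dist_axis_ray_compl => t t0; exact: lt_le_trans (kz _ t0).
have zr' : ray_compl z'.
  apply: dist_axis_ray_compl => t t0; apply: lt_le_trans (D _ t0).
  by rewrite mulr_gt0 ?subr_gt0// dist_axis_pos.
split=> //; rewrite -RintegralZl//; last exact: integrable_kernel.
apply: le_Rintegral => //; [|exact: integrable_kernel|].
  apply: (@integrableZl _ _ _ mu `[0, +oo[ _ (1 - e)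
    (fun x => (kernel z' x)%:E)) => //; exact: integrable_kernel.
move=> x /=; rewrite in_itv/= andbT => x0.
have := D _ (powR_ge0 x alpha); rewrite /kernel.
rewrite ler_pdivrMr ?dist_axis_pos ?powR_ge0// [X in _ -> _ <= X]mulrC.
by rewrite ler_pdivlMr ?dist_axis_pos ?powR_ge0.
Qed.

Lemma conformal_factor_continuous z : ray_compl z -> {for z, continuous f}.
Proof.
move=> zr; have [k /andP[k0 _] kz] := ray_compl_dist zr.
apply/(@cvgrPdist_lt _ _ _ (nbhs z)) => e e0; apply/nbhs_euclP.
have fz0 := conformal_factor_ge0 z.
pose d := Num.min 4^-1 (e / (4 * (f z + 1))).
have d0 : 0 < d by rewrite lt_min invr_gt0 ltr0n/= divr_gt0// mulr_gt0// ltr_wpDl.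
have d4 : d <= 4^-1 by rewrite ge_min lexx.
have de : 4 * d * (f z + 1) <= e.
  have : d <= e / (4 * (f z + 1)) by rewrite ge_min lexx orbT.
  by rewrite ler_pdivlMr; [lra|rewrite mulr_gt0// ltr_wpDl].
exists (d * k); first by rewrite mulr_gt0.
move=> z' zz'.
have d01 : 0 <= d < 1 by apply/andP; split; lra.
have /(conformal_factor_near k0 d01 kz)[zr' H1] : eucl_norm (z - z') <= d * k.
  by rewrite eucl_distC ltW.
have k'0 : 0 < (1 - d) * k by rewrite mulr_gt0//; lra.
have kz' t : 0 <= t -> (1 - d) * k <= eucl_norm (z' - axis_pt t).
  move=> t0; have := kz _ t0; have := eucl_distD z' z (axis_pt t).
  by move: zz'; rewrite eucl_distC; nra.
have d02 : 0 <= 2 * d < 1 by apply/andP; split; lra.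
have [|_ H2] := conformal_factor_near k'0 d02 kz' (z' := z).
  apply: le_trans (ltW zz') _.
  have := mulr_gt0 d0 k0; set dk := d * k => dk0.
  have -> : 2 * d * ((1 - d) * k) = 2 * (1 - d) * dk by rewrite /dk; ring.
  nra.
rewrite ltr_norml; have := conformal_factor_ge0 z'; nra.
Qed.

(** The substitution of [l `^ alpha^-1 * x] for [x] moves the source by the factor
    [l]. *)
Lemma conformal_factorZ l z : 0 < l -> ray_compl z ->
  f (l *: z) = l `^ (alpha^-1 - 1) * f z.
Proof.
move=> l0 zr; have lzr := ray_complZ l0 zr.
pose c := l `^ alpha^-1; have c0 : 0 < c by exact: powR_gt0.
have cl x : 0 <= x -> (c * x) `^ alpha = l * x `^ alpha.
  move=> x0; rewrite (powRM _ (ltW c0) x0) -powRrM mulVf ?gt_eqF//.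
  by rewrite powRr1// ltW.
have kl x : 0 <= x -> kernel (l *: z) (c * x) * c = l^-1 * c * kernel z x.
  move=> x0; rewrite /kernel cl// axis_ptZ -scalerBr eucl_normZ gtr0_norm//.
  by rewrite invfM mulrAC.
have d1 x : is_derive x 1 (fun x : R => c * x) c.
  by have := is_deriveZ c (is_derive_id x 1); rewrite /GRing.scale/= mulr1.
have dE : derive1 (fun x : R => c * x) = cst c.
  by apply/funext => x; rewrite derive1E; have [] := d1 x.
have H := @increasing_ge0_integration_by_substitutiony R
  (fun x => c * x) (kernel (l *: z)) 0.
rewrite /conformal_factor /Rintegral.
have -> : (\int[mu]_(x in `[0%R, +oo[) (kernel (l *: z) x)%:E =
  \int[mu]_(x in `[0%R, +oo[) (l^-1 * c * kernel z x)%:E)%E.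
  rewrite mulr0 in H; rewrite H.
  - apply: eq_integral => x; rewrite inE/= in_itv/= andbT => x0.
    by rewrite -(kl _ x0) dE.
  - by move=> x y _ _ xy; rewrite ltr_pM2l.
  - by move=> x _; rewrite dE; exact: cst_continuous.
  - by rewrite dE; exact: is_cvg_cst.
  - by rewrite dE; exact: is_cvg_cst.
  - split; first by move=> x _; have [] := d1 x.
    exact/cvg_at_right_filter/(is_derive1_continuous (d1 0)).
  - exact: gt0_cvgMry.
  - exact: continuous_kernel.
  - by move=> x _; exact: kernel_ge0.
transitivity (l^-1 * c * f z).
  by rewrite -RintegralZl//; exact: integrable_kernel.
congr *%R; rewrite powRB; last by rewrite (gt_eqF l0) implybT.
by rewrite powRr1 ?ltW// mulrC.
Qed.

(** In particular rotations and reflections about the axis preserve the factor. *)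
Lemma eq_conformal_factor z z' :
  (forall t, eucl_norm (z - axis_pt t) = eucl_norm (z' - axis_pt t)) ->
  f z = f z'.
Proof. by move=> zz'; apply: eq_Rintegral => x _; rewrite zz'. Qed.

End conformal.

(** * Piecewise differentiable functions *)

Section piecewise.
Context {R : realType}.
Implicit Types (a b t x : R) (S s : seq R) (F G : R -> R).

(** The monotonicity criterion survives finitely many exceptional points,
    because the function is continuous across them. *)
Lemma nonneg_derive_le_exc S F a b : a <= b ->
  {within `[a, b], continuous F} ->
  (forall t, t \in `]a, b[ -> t \notin S ->
     exists2 d, 0 <= d & is_derive t 1 F d) ->
  F a <= F b.
Proof.
elim: S a b => [|x S IH] a b; rewrite le_eqVlt => /predU1P[->//|ab] cF dF.
  apply: (@ger0_derive1_ndecr _ F a b) => //; try exact: ltW.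
    by move=> x /dF[]// d _ [].
  by move=> x /dF[]// d d0 [_ Fd]; rewrite derive1E Fd.
have [/andP[ax xb]|xab] := boolP (a < x < b); last first.
  apply: IH => //; first exact: ltW.
  move=> t tab tS; apply: dF => //; rewrite in_cons negb_or tS andbT.
  by apply: contraNneq xab => <-; move: tab; rewrite in_itv.
have sub c d : a <= c -> d <= b -> {within `[c, d], continuous F}.
  by move=> ac db; apply: continuous_subspaceW cF; apply: subset_itv; rewrite bnd_simp.
apply: (@le_trans _ _ (F x)).
  apply: IH; [exact: ltW|by apply: sub; [|exact: ltW]|].
  move=> t; rewrite in_itv/= => /andP[at_ tx] tS; apply: dF.
    by rewrite in_itv/= at_ (lt_trans tx).
  by rewrite in_cons negb_or tS andbT lt_eqF.
apply: IH; [exact: ltW|by apply: sub; [exact: ltW|]|].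
move=> t; rewrite in_itv/= => /andP[xt tb] tS; apply: dF.
  by rewrite in_itv/= tb (lt_trans ax).
by rewrite in_cons negb_or tS andbT gt_eqF.
Qed.

(** The comparison principle by which arc lengths are estimated throughout. *)
Lemma derive_le_exc S F G a b : a <= b ->
  {within `[a, b], continuous F} -> {within `[a, b], continuous G} ->
  (forall t, t \in `]a, b[ -> t \notin S ->
     exists d e, [/\ is_derive t 1 F d, is_derive t 1 G e & d <= e]) ->
  F b - F a <= G b - G a.
Proof.
move=> ab cF cG dFG.
have : (G \- F) a <= (G \- F) b.
  apply: (@nonneg_derive_le_exc S) => //.
    by move=> t; apply: cvgB; [exact: cG|exact: cF].
  move=> t tab tS; have [d [e [Fd Ge de]]] := dFG t tab tS.
  by exists (e - d); [rewrite subr_ge0|exact: is_deriveB].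
rewrite /=; lra.
Qed.

Lemma itv_partition_between s a b t : itv_partition a b s -> a < b ->
  a <= t <= b -> exists2 i, (i < size s)%N &
    nth b (a :: s) i <= t <= nth b (a :: s) i.+1.
Proof.
elim: s a => [|x s IH] a sP ab /andP[at_ tb].
  by move: ab; rewrite (itv_partition_nil sP) ltxx.
have [tx|xt] := leP t x; first by exists 0%N => //=; rewrite at_.
have [||i si ti] := IH x (itv_partition_cons sP).
- exact: lt_le_trans tb.
- by rewrite ltW.
- by exists i.+1.
Qed.

Lemma itv_partition_nth s a b i : itv_partition a b s -> a <= b ->
  (i <= size s)%N -> a <= nth b (a :: s) i <= b.
Proof.
elim: s a i => [|x s IH] a [|i] sP ab //= si; rewrite ?lexx ?ab//.
have [/= /andP[ax _] _] := sP.
have sP' := itv_partition_cons sP.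
have xb : x <= b.
  have [p /eqP <-] := sP'.
  by have := order_path_min lt_trans p => /allP H; case: (s) H => //= y s' H;
     apply: ltW; apply: H; exact: mem_last.
have /andP[xs ->] := IH x i sP' xb si.
by rewrite (le_trans (ltW ax) xs).
Qed.

Lemma continuous_piecewise (T : topologicalType) (c : R -> T) s a b :
  itv_partition a b s -> a <= b ->
  (forall i, (i < size s)%N ->
    {within `[nth b (a :: s) i, nth b (a :: s) i.+1], continuous c}) ->
  {within `[a, b], continuous c}.
Proof.
elim: s a => [|x s IH] a sP ab cc.
  by rewrite (itv_partition_nil sP) set_itv1; exact: continuous_subspace1.
have [/= /andP[ax _] _] := sP.
have /andP[_ xb] := @itv_partition_nth _ _ _ 1%N sP ab isT.
have -> : `[a, b]%classic = `[a, x] `|` `[x, b].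
  rewrite predeqE => t /=; rewrite !in_itv/=; split.
    by move=> /andP[-> ->]; rewrite andbT; case: (leP t x) => [|/ltW ->]; [left|right].
  by move=> [/andP[-> tx]|/andP[xt ->]]; rewrite ?andbT/=;
    [exact: le_trans tx xb|exact: le_trans (ltW ax) xt].
apply: withinU_continuous; [exact: interval_closed|exact: interval_closed| |].
  exact: (cc 0%N).
by apply: (IH x (itv_partition_cons sP) xb) => i si; exact: (cc i.+1).
Qed.

Lemma uniform_bound (n : nat) (T : Type) (P : nat -> T -> Prop) (h : T -> R) :
  (forall i, (i < n)%N -> exists B, forall u, P i u -> h u <= B) ->
  exists B, forall i u, (i < n)%N -> P i u -> h u <= B.
Proof.
elim: n => [|n IH] hP; first by exists 0.
have [i /ltnW|B BP] := IH; first exact: hP.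
have [B' B'P] := hP n (ltnSn n).
exists (Num.max B B') => i t; rewrite ltnS leq_eqVlt => /predU1P[->|si] Pt.
  by rewrite le_max B'P ?orbT.
by rewrite le_max (BP i t).
Qed.

End piecewise.

(** * Lengths of piecewise smooth curves *)

Section curves.
Context {R : realType} (alpha : R) (alpha_gt1 : 1 < alpha).
Local Notation E3 := 'rV[R]_3.
Local Notation mu := (@lebesgue_measure R).
Local Notation f := (@conformal_factor R alpha).
Implicit Types (c : R -> E3) (S : seq R) (L : R -> R) (t : R).

Definition speed c t : R := Num.sqrt (f (c t)) * eucl_norm (derive1 c t).

Definition admissible c := piecewise_C1 c /\ forall t, t \in `[0, 1] -> ray_compl (c t).

Lemma piecewise_C1_continuous c : piecewise_C1 c -> {within `[0, 1], continuous c}.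
Proof.
move=> [s sP cP]; apply: (continuous_piecewise sP) => // i si.
have [g [dg _ cg]] := cP i si.
have gi : {within `[nth 1 (0 :: s) i, nth 1 (0 :: s) i.+1], continuous g}.
  apply: continuous_subspaceT => t.
  by have /derivableP/is_derive1_continuous := dg t.
apply: subspace_eq_continuous gi => t; rewrite inE/= => ti.
exact/esym/cg.
Qed.

(** Away from the finitely many corners, a piecewise smooth curve is locally one
    of its smooth pieces. *)
Lemma piecewise_C1_local c : piecewise_C1 c -> exists (S : seq R) (B : R),
  forall t, t \in `]0, 1[ -> t \notin S -> exists g : R -> E3,
    [/\ forall u, derivable g u 1, continuous (derive1 g),
        \forall u \near t, c u = g u & eucl_norm (derive1 g t) <= B].
Proof.
move=> [s sP cP].
pose P i t := (t \in `]0, 1[) /\ t \in `]nth 1 (0 :: s) i, nth 1 (0 :: s) i.+1[.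
have near_piece i g t : (forall t, t \in `[nth 1 (0 :: s) i, nth 1 (0 :: s) i.+1] -> c t = g t) ->
    t \in `]nth 1 (0 :: s) i, nth 1 (0 :: s) i.+1[ -> (\forall u \near t, c u = g u).
  move=> cg ti; near=> u; apply: cg; apply: subset_itv_oo_cc.
  by near: u; exact: near_in_itvoo.
have [B BP] : exists B, forall i t, (i < size s)%N -> P i t -> eucl_norm (derive1 c t) <= B.
  apply: uniform_bound => i si; have [g [dg cg' cg]] := cP i si.
  have [||m _ mP] := @EVT_max R (fun t => eucl_norm (derive1 g t)) 0 1 => //.
    apply: continuous_subspaceT => t.
    apply: (@continuous_comp _ _ _ (derive1 g) (@eucl_norm R)); first exact: cg'.
    exact: continuous_eucl_norm.
  exists (eucl_norm (derive1 g m)) => t [t01 ti].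
  rewrite derive1E (near_eq_derive _ (near_piece _ _ _ cg ti)) -derive1E mP//.
  exact: subset_itv_oo_cc.
exists (0 :: s), B => t t01 tS.
have /(itv_partition_between sP ltr01)[i si ti] : 0 <= t <= 1.
  exact: (subset_itv_oo_cc t01).
have {}ti : t \in `]nth 1 (0 :: s) i, nth 1 (0 :: s) i.+1[.
  rewrite in_itv/= !lt_neqAle; case/andP: ti => -> ->; rewrite !andbT.
  apply/andP; split.
    by apply: contraNneq tS => <-; rewrite mem_nth//= ltnS ltnW.
  by apply: contraNneq tS => ->; rewrite in_cons mem_nth ?orbT.
have [g [dg cg' cg]] := cP i si; exists g; split => //.
  exact: near_piece cg ti.
have := BP i t si (conj t01 ti).
by rewrite derive1E (near_eq_derive _ (near_piece _ _ _ cg ti)) -derive1E.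
Unshelve. all: by end_near. Qed.

(** Outside the finite set [S] of corners, [L] is a primitive of the speed.  Lengths
    are handled through such an [L] because, unlike the integral, it behaves well
    under reparametrization by the chain rule alone. *)
Definition arc_length c S L :=
  {within `[0, 1], continuous L} /\
  forall t, t \in `]0, 1[ -> t \notin S ->
    derivable c t 1 /\ is_derive t 1 L (speed c t).

Lemma speed_ge0 c t : 0 <= speed c t.
Proof. by rewrite mulr_ge0 ?sqrtr_ge0 ?eucl_norm_ge0. Qed.

Lemma continuous_sqrt_conformal c : admissible c ->
  {within `[0, 1], continuous (fun t => Num.sqrt (f (c t)))}.
Proof.
move=> [/piecewise_C1_continuous/subspace_continuousP cc cr].
apply/subspace_continuousP => t t01.
have h := cvg_comp _ _ (cc t t01) (conformal_factor_continuous alpha_gt1 (cr _ t01)).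
exact: (cvg_comp _ _ h (@sqrt_continuous _ _)).
Qed.

Lemma finite_set_measurable (A : set R) : finite_set A -> measurable A.
Proof.
by move=> Af; apply: countable_measurable => //; exact: finite_set_countable.
Qed.

(** The speed is bounded, and continuous off a finite set; the values of [derive1 c]
    at the corners are arbitrary but finite in number. *)
Lemma piecewise_speed_integrable c S (B : R) : admissible c ->
  {in [set t | (t \in `]0, 1[) /\ t \notin S], continuous (speed c)} ->
  (forall t, t \in `]0, 1[ -> t \notin S -> eucl_norm (derive1 c t) <= B) ->
  mu.-integrable `[0, 1] (EFin \o speed c).
Proof.
move=> cadm cU cB.
pose U := [set t : R | (t \in `]0, 1[) /\ t \notin S].
pose F := [set` [:: 0, 1 & S]].
have Ff : finite_set F by exact: finite_seq.
have UF t : t \in `[0, 1] -> (t \in `]0, 1[) /\ t \notin S \/ t \in [:: 0, 1 & S].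
  have [->|t0] := eqVneq t 0; first by right; rewrite in_cons eqxx.
  have [->|t1] := eqVneq t 1; first by right; rewrite !in_cons eqxx orbT.
  have [tS|tS] := boolP (t \in S); first by right; rewrite !in_cons tS !orbT.
  rewrite !in_itv/= => /andP[t0' t1']; left; split => //.
  by rewrite !lt_neqAle eq_sym t0 t0' t1 t1'.
have mU : measurable U.
  have -> : U = `]0, 1[ `\` [set` S].
    by apply/seteqP; split => t /= [tU /negP tS]; split => //; exact/negP.
  by apply: measurableD => //; apply: finite_set_measurable; exact: finite_seq.
apply: measurable_bounded_integrable => //.
- by have := @lebesgue_measure_itv R `[0, 1]; rewrite /= => ->; rewrite lte_fin ltr01 ltry.
- have -> : `[0, 1]%classic = U `|` (F `&` `[0, 1]).
    apply/seteqP; split => t /=; first by move=> t01; case: (UF _ t01); [left|right].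
    by move=> [[tU _]|[]//]; exact: subset_itv_oo_cc.
  apply/measurable_funU => //.
    by apply: measurableI => //; exact: finite_set_measurable.
  split.
    apply: open_continuous_measurable_fun; last exact: cU.
    have -> : U = `]0, 1[ `&` ~` [set` S].
      by apply/seteqP; split => t /= [tU /negP tS]; split => //; exact/negP.
    apply: openI; first exact: interval_open.
    apply: closed_openC.
    apply: (accessible_finite_set_closed.1 _ _ (finite_seq _)).
    by apply: hausdorff_accessible; exact: norm_hausdorff.
  move=> _ Y mY; apply: finite_set_measurable.
  by do 2 apply: finite_setIl.
- have [m m01 mP] := EVT_max ler01 (continuous_sqrt_conformal cadm).
  pose M := Num.sqrt (f (c m)) * Num.max B 0 + \sum_(u <- [:: 0, 1 & S]) speed c u.
  have M0 t : t \in [:: 0, 1 & S] -> speed c t <= \sum_(u <- [:: 0, 1 & S]) speed c u.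
    move=> tF; rewrite (big_rem t)//= lerDl; apply: sumr_ge0 => u _; exact: speed_ge0.
  have B0 : 0 <= Num.max B 0 by rewrite le_max lexx orbT.
  exists M; split; first exact: num_real.
  move=> x Mx t /= t01; rewrite ger0_norm ?speed_ge0//; apply: le_trans (ltW Mx).
  have [[tU tS]|tF] := UF t t01; last first.
    by apply: le_trans (M0 _ tF) _; rewrite /M lerDr mulr_ge0 ?sqrtr_ge0.
  rewrite /M -[leLHS]addr0 lerD//; last by apply: sumr_ge0 => u _; exact: speed_ge0.
  apply: ler_pM; rewrite ?sqrtr_ge0 ?eucl_norm_ge0//; first exact: mP.
  by rewrite le_max cB.
Qed.

(** The partial integrals of the speed form an arc-length function, by the
    fundamental theorem of calculus at the points of continuity. *)
Lemma admissible_arc_length c : admissible c ->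
  exists S L, arc_length c S L /\ riem_length alpha c = L 1 - L 0.
Proof.
move=> cadm; have [cpw cr] := cadm.
have [S [B SP]] := piecewise_C1_local cpw.
have sc t : t \in `]0, 1[ -> t \notin S -> {for t, continuous (speed c)}.
  move=> t01 tS; have [g [dg cg' cg gB]] := SP t t01 tS.
  have sE : \forall u \near t, Num.sqrt (f (g u)) * eucl_norm (derive1 g u) = speed c u.
    near=> u; rewrite /speed.
    have cgu : \forall v \near u, c v = g v by near: u; exact: near_join cg.
    by rewrite (nbhs_singleton cgu) !derive1E (near_eq_derive _ cgu).
  have ct : c t = g t by exact: nbhs_singleton cg.
  have gt : {for t, continuous g} by exact: is_derive1_continuous (derivableP (dg t)).
  have gr : ray_compl (g t) by rewrite -ct; apply: cr; exact: subset_itv_oo_cc.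
  rewrite /prop_for /continuous_at -(nbhs_singleton sE).
  apply: cvg_trans (near_eq_cvg sE) _.
  apply: cvgM.
    have h := cvg_comp _ _ gt (conformal_factor_continuous alpha_gt1 gr).
    exact: (cvg_comp _ _ h (@sqrt_continuous _ _)).
  exact: (cvg_comp _ _ (cg' t) (@continuous_eucl_norm _ _)).
have si : mu.-integrable `[0, 1] (EFin \o speed c).
  apply: (@piecewise_speed_integrable c S B) => //.
    by move=> t /[!inE] -[t01 tS]; exact: sc.
  move=> t t01 tS; have [g [dg cg' cg gB]] := SP t t01 tS.
  by rewrite derive1E (near_eq_derive _ cg) -derive1E.
exists S, (fun t => \int[mu]_(u in `[0, t]) speed c u); split; last first.
  by rewrite set_itv1 Rintegral_set1 subr0.
split; first exact: parameterized_integral_continuous.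
move=> t t01 tS; split.
  have [g [dg _ cg _]] := SP t t01 tS.
  apply: (near_eq_derivable _ (dg t)); near=> u; apply/esym.
  by near: u; exact: cg.
move: (t01); rewrite in_itv/= => /andP[t0 t1].
have [dL L'] := continuous_FTC1_closed t1 si t0 (sc t t01 tS).
by split; [exact: dL|rewrite -derive1E; exact: L'].
Unshelve. all: by end_near. Qed.

Lemma arc_length_unique c S L S' L' :
  arc_length c S L -> arc_length c S' L' -> L 1 - L 0 = L' 1 - L' 0.
Proof.
suff le S1 L1 S2 L2 : arc_length c S1 L1 -> arc_length c S2 L2 ->
    L1 1 - L1 0 <= L2 1 - L2 0.
  by move=> cL cL'; apply/eqP; rewrite eq_le (le _ _ _ _ cL cL') (le _ _ _ _ cL' cL).
move=> [cL1 dL1] [cL2 dL2]; apply: (@derive_le_exc _ (S1 ++ S2)) => // t t01.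
rewrite mem_cat negb_or => /andP[tS1 tS2].
exists (speed c t), (speed c t).
by split => //; [have [] := dL1 t t01 tS1|have [] := dL2 t t01 tS2].
Qed.

Lemma riem_lengthE c S L : admissible c -> arc_length c S L ->
  riem_length alpha c = L 1 - L 0.
Proof.
move=> /admissible_arc_length[S' [L' [cL' ->]]] cL.
exact: arc_length_unique cL' cL.
Qed.

End curves.

(** * Reparametrization, concatenation and linear images of curves *)

Section derivatives.
Context {R : realType}.

Lemma is_derive_affine (V : normedModType R) (g : R -> V) (u v t : R) (d : V) :
  is_derive (u * t + v) 1 g d ->
  is_derive t 1 (fun s => g (u * s + v)) (u *: d).
Proof.
move=> gd.
have md : is_derive t 1 (fun s => u * s + v) u.
  have := is_deriveD (is_deriveZ u (is_derive_id t 1)) (is_derive_cst v t 1).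
  by rewrite /GRing.scale/= mulr1 addr0.
have dg : differentiable g (u * t + v) by apply/derivable1_diffP.
have dm : differentiable (fun s => u * s + v) t by apply/derivable1_diffP.
have dc : differentiable (g \o (fun s => u * s + v)) t by exact: differentiable_comp.
apply: DeriveDef; first exact/derivable1_diffP.
rewrite deriveE// diff_comp//=.
have -> : 'd (fun s => u * s + v) t 1 = u by rewrite -deriveE// derive_val.
have -> : 'd g (u * t + v) u = u *: 'd g (u * t + v) 1.
  by rewrite -linearZ/= /GRing.scale/= mulr1.
by rewrite -deriveE// (@derive_val _ _ _ _ _ _ _ gd).
Qed.

Lemma is_derive_linear (V W : normedModType R) (phi : V -> W) (g : R -> V)
    (t : R) (d : V) :
  (forall k u v, phi (k *: u + v) = k *: phi u + phi v) -> continuous phi ->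
  is_derive t 1 g d -> is_derive t 1 (phi \o g) (phi d).
Proof.
move=> phil phic [dg gd].
have phiB u v : phi (u - v) = phi u - phi v.
  by rewrite addrC -scaleN1r phil scaleN1r addrC.
have phiZ k u : phi (k *: u) = k *: phi u.
  have phi0 : phi 0 = 0 by rewrite -(subrr 0) phiB subrr.
  by rewrite -[k *: u]addr0 phil phi0 addr0.
have H : h^-1 *: ((phi \o g) (h *: 1 + t) - (phi \o g) t) @[h --> 0^'] --> phi d.
  have -> : (fun h => h^-1 *: ((phi \o g) (h *: 1 + t) - (phi \o g) t)) =
      phi \o (fun h : R => h^-1 *: (g (h *: (1 : R) + t) - g t)).
    by apply/funext => h /=; rewrite phiZ phiB.
  apply: continuous_cvg; first exact: phic.
  by rewrite -gd; exact: dg.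
apply: DeriveDef; first by apply/cvg_ex; exists (phi d).
exact: cvg_lim.
Qed.

End derivatives.

Section smooth_pieces.
Context {R : realType}.
Local Notation E3 := 'rV[R]_3.
Implicit Types (c : R -> E3) (a b t u v : R).

Definition C1_on c a b := exists g : R -> E3,
  [/\ forall t, derivable g t 1, continuous (derive1 g)
    & forall t, t \in `[a, b] -> c t = g t].

(** The inductive form of [piecewise_C1]: it replaces the indices of a partition by
    structural recursion (see [piecewise_C1P]). *)
Inductive piecewise_on c : R -> R -> Prop :=
| piecewise_nil a : piecewise_on c a a
| piecewise_cons a x b :
    a < x -> C1_on c a x -> piecewise_on c x b -> piecewise_on c a b.

Lemma piecewise_C1P c : piecewise_C1 c <-> piecewise_on c 0 1.
Proof.
split=> [[s]|].
  elim: s 0 => [|x s IH] a sP cP; first by rewrite (itv_partition_nil sP); left.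
  have [/= /andP[ax _] _] := sP.
  apply: (piecewise_cons ax (cP 0%N isT)).
  by apply: IH (itv_partition_cons sP) _ => i si; exact: (cP i.+1).
suff H a b : piecewise_on c a b -> exists2 s, itv_partition a b s &
    forall i, (i < size s)%N -> C1_on c (nth b (a :: s) i) (nth b (a :: s) i.+1).
  by move/H.
elim=> {a b} [a|a x b ax cx _ [s [sp sl] sP]]; first by exists [::]; first by split=> /=.
by exists (x :: s); [split; rewrite /= ?ax|case=> [|i] //; exact: sP].
Qed.

Lemma piecewise_on_le c a b : piecewise_on c a b -> a <= b.
Proof. by elim=> // {}a x {}b ax _ _; apply: le_trans; exact: ltW. Qed.

Lemma piecewise_on_cat c a x b :
  piecewise_on c a x -> piecewise_on c x b -> piecewise_on c a b.
Proof.
by elim=> // {}a y {}x ay cy _ IH /IH; exact: piecewise_cons.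
Qed.

Lemma C1_on_affine c a b u v a' b' :
  (forall t, t \in `[a', b'] -> u * t + v \in `[a, b]) ->
  C1_on c a b -> C1_on (fun t => c (u * t + v)) a' b'.
Proof.
move=> ab [g [dg cg cgE]]; exists (fun t => g (u * t + v)).
have dG t : is_derive t 1 (fun t => g (u * t + v)) (u *: derive1 g (u * t + v)).
  by apply: is_derive_affine; rewrite derive1E; exact/derivableP.
split=> [t|t|t /ab]; [by have [] := dG t| |exact: cgE].
have -> : derive1 (fun t => g (u * t + v)) = (fun t => u *: derive1 g (u * t + v)).
  by apply/funext => s; rewrite derive1E; have [] := dG s.
apply: cvgZr.
apply: (@continuous_comp _ _ _ (fun t => u * t + v) (derive1 g)); last exact: cg.
by apply: cvgD; [exact: cvgMr|exact: cvg_cst].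
Qed.

Lemma piecewise_on_affine c a b u v : 0 < u -> piecewise_on c a b ->
  piecewise_on (fun t => c (u * t + v)) ((a - v) / u) ((b - v) / u).
Proof.
move=> u0; elim=> {a b} [a|a x b ax cx _ IH]; first exact: piecewise_nil.
apply: piecewise_cons IH; first by rewrite ltr_pM2r ?invr_gt0// ltrD2r.
apply: C1_on_affine cx => t.
by rewrite !in_itv/= ler_pdivlMr// ler_pdivrMr// lerBlDr lerBrDr mulrC.
Qed.

(** Reversal turns the first piece into the last one, hence the concatenation. *)
Lemma piecewise_on_opp c a b : piecewise_on c a b ->
  piecewise_on (fun t => c (- t)) (- b) (- a).
Proof.
elim=> {a b} [a|a x b ax cx _ IH]; first exact: piecewise_nil.
apply: piecewise_on_cat IH _; apply: piecewise_cons (piecewise_nil _ _).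
  by rewrite ltrN2.
have -> : (fun t => c (- t)) = (fun t => c (- 1 * t + 0)).
  by apply/funext => t; rewrite mulN1r addr0.
apply: C1_on_affine cx => t.
by rewrite mulN1r addr0 !in_itv/= lerNl lerNr andbC lerNl (lerNr a).
Qed.

Lemma piecewise_on_ext c c' a b : (forall t, t \in `[a, b] -> c t = c' t) ->
  piecewise_on c a b -> piecewise_on c' a b.
Proof.
move=> + cab; elim: cab => {a b} [a|a x b ax [g [dg cg cgE]] xb IH] cc'.
  exact: piecewise_nil.
have xb' := piecewise_on_le xb.
apply: (piecewise_cons ax); last first.
  apply: IH => t; rewrite in_itv/= => /andP[xt tb]; apply: cc'.
  by rewrite in_itv/= tb (le_trans (ltW ax) xt).
exists g; split => // t tax; rewrite -cgE// cc'//.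
by move: tax; rewrite !in_itv/= => /andP[-> tx]; exact: le_trans tx xb'.
Qed.

Lemma piecewise_on_linear (phi : E3 -> E3) c a b :
  (forall k (p q : E3), phi (k *: p + q) = k *: phi p + phi q) -> continuous phi ->
  piecewise_on c a b -> piecewise_on (phi \o c) a b.
Proof.
move=> phil phic; elim=> {a b} [a|a x b ax [g [dg cg cgE]] _ IH].
  exact: piecewise_nil.
apply: piecewise_cons ax _ IH; exists (phi \o g).
have dG t : is_derive t 1 (phi \o g) (phi (derive1 g t)).
  by apply: is_derive_linear => //; rewrite derive1E; exact/derivableP.
split=> [t|t|t /cgE /= -> //]; first by have [] := dG t.
have -> : derive1 (phi \o g) = phi \o derive1 g.
  by apply/funext => s; rewrite derive1E; have [] := dG s.
exact: continuous_comp (cg t) (phic _).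
Qed.

End smooth_pieces.

Section arc_length_calculus.
Context {R : realType} (alpha : R) (alpha_gt1 : 1 < alpha).
Local Notation E3 := 'rV[R]_3.
Local Notation f := (@conformal_factor R alpha).
Local Notation len := (riem_length alpha).
Implicit Types (c : R -> E3) (S : seq R) (L : R -> R) (t u v : R).

Lemma arc_length_le c S L a b : arc_length alpha c S L ->
  0 <= a -> a <= b -> b <= 1 -> L a <= L b.
Proof.
move=> [cL dL] a0 ab b1; apply: (@nonneg_derive_le_exc _ S) => //.
  by apply: continuous_subspaceW cL; apply: subset_itv; rewrite bnd_simp.
move=> t; rewrite in_itv/= => /andP[at_ tb] tS.
have [|_ dLt] := dL t _ tS.
  by rewrite in_itv/= (le_lt_trans a0 at_) (lt_le_trans tb b1).
by exists (speed alpha c t) => //; exact: speed_ge0.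
Qed.

Lemma riem_length_ge0 c : admissible c -> 0 <= len c.
Proof.
move=> /(admissible_arc_length alpha_gt1)[S [L [cL ->]]].
by rewrite subr_ge0; apply: arc_length_le cL _ _ _.
Qed.

Lemma within_continuous_affine L u v :
  {within `[0, 1], continuous L} ->
  (forall t, t \in `[0, 1] -> u * t + v \in `[0, 1]) ->
  {within `[0, 1], continuous (fun t => L (u * t + v))}.
Proof.
move=> /subspace_continuousP cL m01; apply/subspace_continuousP => t t01.
have cm : (fun t => u * t + v) @ t --> u * t + v.
  by apply: cvgD; [exact: cvgMr|exact: cvg_cst].
have cw : u * s + v @[s --> within `[0, 1] (nbhs t)] -->
    within `[0, 1] (nbhs (u * t + v)).
  move=> P PP; have H := cm _ PP.
  by apply: (@filterS _ (nbhs t) _ _ _ _ H) => s Ps s01; apply: Ps; exact: m01.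
exact: (cvg_comp _ _ cw (cL _ (m01 _ t01))).
Qed.

(** By the chain rule [Num.sg u * L (u * t + v)] is an arc-length function of the
    reparametrized curve.  This covers restriction to a subinterval as well as
    reversal. *)
Lemma riem_length_affine c c' S L u v :
  admissible c' -> arc_length alpha c S L -> u != 0 ->
  (forall t, t \in `[0, 1] -> u * t + v \in `[0, 1]) ->
  (forall t, t \in `[0, 1] -> c' t = c (u * t + v)) ->
  len c' = Num.sg u * (L (u + v) - L v).
Proof.
move=> adm [cL dL] u0 m01 cE.
have /(riem_lengthE alpha_gt1 adm) -> :
    arc_length alpha c' [seq (x - v) / u | x <- S] (fun t => Num.sg u * L (u * t + v)).
  split.
    have := within_continuous_affine cL m01 => /subspace_continuousP H.
    by apply/subspace_continuousP => t t01; apply: cvgMr; exact: H.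
  move=> t t01 tS.
  have mS : u * t + v \notin S.
    by apply: contra tS => mS; apply/mapP; exists (u * t + v) => //; rewrite addrK mulrC mulKf.
  have mt : u * t + v \in `]0, 1[.
    have /andP[uv0 uv1] : 0 <= u + v <= 1.
      by have := m01 1; rewrite !in_itv/= ler01 lexx mulr1; apply.
    have /andP[v0 v1] : 0 <= v <= 1.
      by have := m01 0; rewrite !in_itv/= ler01 lexx mulr0 add0r; apply.
    rewrite in_itv/=.
    move: t01; rewrite in_itv/= => /andP[t0 t1].
    have [un|up] : u < 0 \/ 0 < u by move: u0; rewrite neq_lt => /orP.
      by apply/andP; split; nra.
    by apply/andP; split; nra.
  have [dc dLm] := dL _ mt mS.
  have dcm : is_derive t 1 (fun s => c (u * s + v)) (u *: derive1 c (u * t + v)).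
    by apply: is_derive_affine; rewrite derive1E; exact/derivableP.
  have cc' : \forall s \near t, c (u * s + v) = c' s.
    near=> s; apply/esym/cE; apply: subset_itv_oo_cc.
    by near: s; exact: near_in_itvoo.
  split; first exact: near_eq_derivable cc' (@ex_derive _ _ _ _ _ _ _ dcm).
  have -> : speed alpha c' t = Num.sg u * (u * speed alpha c (u * t + v)).
    rewrite /speed -(nbhs_singleton cc') (derive1E c') -(near_eq_derive _ cc').
    rewrite (@derive_val _ _ _ _ _ _ _ dcm) eucl_normZ normrEsg.
    ring.
  apply: is_deriveZ; have := is_derive_affine dLm.
  by rewrite /GRing.scale/=.
by rewrite mulr1 mulr0 add0r mulrBr.
Unshelve. all: by end_near. Qed.

End arc_length_calculus.

(** * The Riemannian distance off the axis *)

Section riemannian.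
Context {R : realType} (alpha : R) (alpha_gt1 : 1 < alpha).
Local Notation E3 := 'rV[R]_3.
Local Notation f := (@conformal_factor R alpha).
Local Notation len := (riem_length alpha).
Local Notation rho := (riem_dist alpha).
Implicit Types (p q r n w : E3) (c : R -> E3) (t : R).

Definition joins p q c := [/\ piecewise_C1 c,
  forall t, t \in `[0, 1] -> ray_compl (c t), c 0 = p & c 1 = q].

Lemma joins_admissible p q c : joins p q c -> admissible c.
Proof. by case. Qed.

Lemma riem_dist_le p q c : joins p q c -> rho p q <= len c.
Proof.
move=> pqc; apply: ge_inf; last by exists c.
exists 0 => _ [c' pqc' <-]; apply: riem_length_ge0 => //.
exact: joins_admissible pqc'.
Qed.

(** The curve [c] guarantees that the infimum is over a nonempty set. *)
Lemma riem_dist_ge p q c (x : R) : joins p q c ->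
  (forall c', joins p q c' -> x <= len c') -> x <= rho p q.
Proof.
move=> pqc xc; apply: lb_le_inf; first by exists (len c), c.
by move=> _ [c' pqc' <-]; exact: xc.
Qed.

Lemma riem_dist_ge0 p q : 0 <= rho p q.
Proof.
have [[c pqc]|no] := pselect (exists c, joins p q c).
  apply: (riem_dist_ge pqc) => c' pqc'; apply: riem_length_ge0 => //.
  exact: joins_admissible pqc'.
rewrite /riem_dist [X in inf X](_ : _ = set0) ?inf0//.
by apply/seteqP; split => // x [c pqc _]; case: no; exists c.
Qed.

(** The arc length of the concatenation restricts, up to an affine change of
    parameter, to arc lengths of its two halves. *)
Lemma joins_cat p q r c1 c2 : joins p q c1 -> joins q r c2 ->
  exists2 c, joins p r c & len c = len c1 + len c2.
Proof.
move=> pq qr; have a1 := joins_admissible pq; have a2 := joins_admissible qr.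
case: pq => /piecewise_C1P P1 r1 p1 q1; case: qr => /piecewise_C1P P2 r2 q2 r2'.
pose c t := if t <= 2^-1 then c1 (2 * t + 0) else c2 (2 * t + -1).
have c2E t : t \in `[2^-1, 1] -> c t = c2 (2 * t + -1).
  rewrite in_itv/= /c => /andP[]; rewrite le_eqVlt => /predU1P[<- _|t2 _].
    by rewrite lexx divff// addr0 subrr q1 q2.
  by rewrite leNgt t2.
have cadm : admissible c.
  split.
    apply/piecewise_C1P; apply: (@piecewise_on_cat _ _ _ 2^-1).
      have := piecewise_on_affine 0 (ltr0Sn R 1) P1.
      rewrite !subr0 mul0r mul1r; apply: piecewise_on_ext => t.
      by rewrite in_itv/= /c => /andP[_ ->].
    have := piecewise_on_affine (-1) (ltr0Sn R 1) P2.
    rewrite !opprK add0r mul1r divff//; apply: piecewise_on_ext => t /c2E ->.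
    by [].
  move=> t; rewrite in_itv/= => /andP[t0 t1]; rewrite /c; case: leP => t2.
    by apply: r1; rewrite in_itv/=; lra.
  by apply: r2; rewrite in_itv/=; lra.
have [S [L [cL lenE]]] := admissible_arc_length alpha_gt1 cadm.
exists c.
  split; [by case: cadm|by case: cadm| |].
    by rewrite /c invr_ge0 ler0n mulr0 addr0.
  by rewrite c2E ?in_itv/= ?lexx ?invf_le1 ?ler1n// mulr1 -[2]/(1 + 1) addrK.
have -> : len c1 = L 2^-1 - L 0.
  rewrite (riem_length_affine alpha_gt1 a1 cL (u := 2^-1) (v := 0)) //.
  - by rewrite gtr0_sg ?invr_gt0// mul1r addr0.
  - by move=> t; rewrite !in_itv/= addr0; lra.
  - move=> t; rewrite in_itv/= addr0 /c => t01.
    by rewrite ifT; [rewrite addr0 mulVKf|lra].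
have -> : len c2 = L 1 - L 2^-1.
  rewrite (riem_length_affine alpha_gt1 a2 cL (u := 2^-1) (v := 2^-1)) //.
  - by rewrite gtr0_sg ?invr_gt0// mul1r; congr (L _ - _); lra.
  - by move=> t; rewrite !in_itv/=; lra.
  - move=> t; rewrite in_itv/= => t01; rewrite c2E; last by rewrite in_itv/=; lra.
    by congr c2; lra.
by rewrite lenE; ring.
Qed.

Lemma joins_opp p q c : joins p q c -> exists2 c', joins q p c' & len c' = len c.
Proof.
move=> pq; have a := joins_admissible pq; case: pq => /piecewise_C1P P r c0 c1.
pose c' t := c (-1 * t + 1).
have m01 t : t \in `[0, 1] -> -1 * t + 1 \in `[0, 1].
  by rewrite !in_itv/=; lra.
have a' : admissible c'.
  split; last by move=> t t01; apply: r; exact: m01.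
  apply/piecewise_C1P.
  have := piecewise_on_affine (-1) ltr01 (piecewise_on_opp P).
  rewrite !opprK !divr1 oppr0 add0r addNr; apply: piecewise_on_ext => t _.
  by rewrite /c'; congr c; lra.
exists c'; first by case: a' => ? ?; split => //; rewrite /c' ?mulr0 ?add0r ?mulr1 ?addNr.
have [S [L [cL ->]]] := admissible_arc_length alpha_gt1 a.
rewrite (riem_length_affine alpha_gt1 a' cL (u := -1) (v := 1)) ?oppr_eq0//.
by rewrite ltr0_sg ?oppr_lt0// addNr; ring.
Qed.

Lemma riem_dist_sym_le p q c : joins p q c -> rho q p <= rho p q.
Proof.
move=> pqc; apply: (riem_dist_ge pqc) => c' /joins_opp[c'' c''P <-].
exact: riem_dist_le.
Qed.

Lemma riem_dist_triangle_path p q r c c' : joins p q c -> joins q r c' ->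
  rho p r <= rho p q + rho q r.
Proof.
move=> pq qr.
rewrite -lerBlDr; apply: (riem_dist_ge pq) => c1 pc1.
rewrite lerBlDr -lerBlDl; apply: (riem_dist_ge qr) => c2 qc2.
rewrite lerBlDl; have [c3 pr <-] := joins_cat pc1 qc2; exact: riem_dist_le.
Qed.

End riemannian.

(** * Upper bounds for the Riemannian distance *)

Section estimates.
Context {R : realType} (alpha : R) (alpha_gt1 : 1 < alpha).
Local Notation E3 := 'rV[R]_3.
Local Notation f := (@conformal_factor R alpha).
Local Notation len := (riem_length alpha).
Local Notation rho := (riem_dist alpha).
Implicit Types (p q r n w : E3) (c : R -> E3) (t k N : R).

Definition seg p q t : E3 := p + t *: (q - p).

Lemma is_derive_seg p q t : is_derive t 1 (seg p q) (q - p).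
Proof.
have : is_derive t 1 ((fun s : R => s *: (q - p)) \o id) (1 *: (q - p)).
  apply: is_derive_linear => [k u v|s]; first by rewrite scalerDl -scalerA.
  exact: (cvgZl cvg_id).
rewrite scale1r; move=> h2; have := is_deriveD (is_derive_cst p t 1) h2.
by rewrite add0r.
Qed.

(** The upper bounds of [rho] come from segments; it is enough to know a primitive [V]
    of a bound of the speed. *)
Lemma riem_dist_seg p q (V : R -> R) :
  (forall t, t \in `[0, 1] -> ray_compl (seg p q t)) ->
  {within `[0, 1], continuous V} ->
  (forall t, t \in `]0, 1[ -> exists2 d, is_derive t 1 V d &
      Num.sqrt (f (seg p q t)) * eucl_norm (q - p) <= d) ->
  joins p q (seg p q) /\ rho p q <= V 1 - V 0.
Proof.
move=> pqr cV dV.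
have dE : derive1 (seg p q) = cst (q - p).
  by apply/funext => t; rewrite derive1E; have [] := is_derive_seg p q t.
have j : joins p q (seg p q).
  split=> //; last 2 first.
  - by rewrite /seg scale0r addr0.
  - by rewrite /seg scale1r addrC subrK.
  apply/piecewise_C1P/(piecewise_cons ltr01 _ (piecewise_nil _ _)).
  exists (seg p q); split => // [t|]; first by have [] := is_derive_seg p q t.
  by rewrite dE; exact: cst_continuous.
split => //; apply: le_trans (riem_dist_le alpha_gt1 j) _.
have [S [L [[cL dL] ->]]] := admissible_arc_length alpha_gt1 (joins_admissible j).
apply: (derive_le_exc (S := S)) => // t t01 tS.
have [_ Lt] := dL t t01 tS; have [d Vt sd] := dV t t01.
by exists (speed alpha (seg p q) t), d; split => //; rewrite /speed dE.
Qed.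

Lemma dot_delta w i : dot w (delta_mx 0 i) = w 0 i.
Proof.
rewrite /dot (bigD1 i)//= big1 ?addr0 ?mxE ?eqxx ?mulr1//.
by move=> j ji; rewrite mxE eqxx (negbTE ji) mulr0.
Qed.

(** A direction orthogonal to the axis in which neither point gets closer to the
    axis: take it orthogonal to [w] and choose its sign according to [w'].  Both
    points can then be moved away from the axis simultaneously. *)
Lemma exists_normal w w' : exists n : E3,
  [/\ n 0 0 = 0, dot n n = 1, 0 <= dot n w & 0 <= dot n w'].
Proof.
suff [n [n0 n1 nw]] : exists n : E3, [/\ n 0 0 = 0, dot n n = 1 & dot n w = 0].
  have [nw'|nw'] := leP 0 (dot n w'); first by exists n; split; rewrite ?nw.
  exists (- n); split; rewrite ?mxE ?dotNl ?dotNr ?n0 ?nw ?opprK ?oppr0//.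
  by rewrite oppr_ge0 ltW.
pose m : E3 := w 0 1 *: delta_mx 0 2%:R - w 0 2%:R *: delta_mx 0 1.
have m0 : m 0 0 = 0 by rewrite !mxE !eqxx /= !mulr0 subr0.
have mw : dot m w = 0 by rewrite dotC !dotE !dot_delta; ring.
have mm : dot m m = axial_sq w.
  rewrite {2}/m !dotE !dot_delta !mxE /= axial_sqE; ring.
have := axial_sq_ge0 w; rewrite le_eqVlt => /predU1P[w0|w0].
  exists (delta_mx 0 1); rewrite dot_delta !mxE /= dotC dot_delta; split => //.
  apply/eqP; rewrite -sqrf_eq0; apply/eqP.
  by move: w0; rewrite axial_sqE; have := sqr_ge0 (w 0 2%:R); have := sqr_ge0 (w 0 1); lra.
exists ((Num.sqrt (axial_sq w))^-1 *: m); split.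
- by rewrite mxE m0 mulr0.
- by rewrite dotZl dotZr mm mulrA -expr2 exprVn sqr_sqrtr ?ltW// mulVf ?gt_eqF.
- by rewrite dotZl mw mulr0.
Qed.

Lemma dist_axis_normal n w t : n 0 0 = 0 -> dot n n = 1 ->
  dot n w <= eucl_norm (w - axis_pt t).
Proof.
move=> n0 n1; have := cauchy_schwarz n (w - axis_pt t).
rewrite dotBr (dotC n (axis_pt t)) dot_axis n0 mulr0 subr0.
by rewrite (eucl_normE n) n1 sqrtr1 mul1r.
Qed.

(** The constant of [conformal_factor_le]: on the ball of radius [N] it bounds the
    conformal factor times the distance to the axis, as long as the latter is at
    most [1]. *)
Definition conformal_bound N := 2 `^ alpha * (N + 2) / (alpha - 1).

Lemma conformal_bound_gt0 N : 0 <= N -> 0 < conformal_bound N.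
Proof.
move=> N0; rewrite /conformal_bound divr_gt0 ?subr_gt0// mulr_gt0 ?powR_gt0//.
by rewrite ltr_wpDl.
Qed.

Lemma conformal_factor_normal N n w k : n 0 0 = 0 -> dot n n = 1 ->
  0 < k <= 1 -> k <= dot n w -> eucl_norm w <= N ->
  ray_compl w /\ f w <= conformal_bound N / k.
Proof.
move=> n0 n1 k01 nw wN; have k0 : 0 < k by case/andP: k01.
have kw t : 0 <= t -> k <= eucl_norm (w - axis_pt t).
  by move=> _; apply: le_trans nw _; exact: dist_axis_normal.
split; last exact: conformal_factor_le.
by apply: dist_axis_ray_compl => t t0; exact: lt_le_trans (kw _ t0).
Qed.

(** At time [t] the segment is at distance at least [t * k] from the axis, so its
    speed is at most a multiple of [sqrt (k / t)], which is integrable. *)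
Lemma riem_dist_normal N n w k : ray_compl w -> eucl_norm w + 1 <= N ->
  n 0 0 = 0 -> dot n n = 1 -> 0 <= dot n w -> 0 < k <= 1 ->
  (exists c, joins w (w + k *: n) c) /\
  rho w (w + k *: n) <= 2 * Num.sqrt (conformal_bound N * k).
Proof.
move=> wr wN n0 n1 nw /andP[k0 k1].
have N0 : 0 <= N by apply: le_trans wN; rewrite addr_ge0 ?eucl_norm_ge0.
have C0 := conformal_bound_gt0 N0; set C := conformal_bound N in C0 *.
have n1' : eucl_norm n = 1 by rewrite eucl_normE n1 sqrtr1.
have segE t : seg w (w + k *: n) t = w + (t * k) *: n.
  by rewrite /seg addrAC subrr add0r scalerA.
have segN t : 0 <= t <= 1 -> eucl_norm (w + (t * k) *: n) <= N.
  move=> /andP[t0 t1]; apply: le_trans (eucl_normD _ _) _; apply: le_trans wN.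
  rewrite lerD2l eucl_normZ n1' mulr1 ger0_norm ?mulr_ge0 ?(ltW k0)//; nra.
have segf t : 0 < t <= 1 ->
    ray_compl (w + (t * k) *: n) /\ f (w + (t * k) *: n) <= C / (t * k).
  move=> /andP[t0 t1]; apply: (@conformal_factor_normal N n) => //.
  - by rewrite mulr_gt0//=; nra.
  - by rewrite dotDr dotZr n1 mulr1 lerDr.
  - by apply: segN; rewrite (ltW t0).
have [|||j le] := @riem_dist_seg w (w + k *: n)
    (fun t => 2 * Num.sqrt (C * k) * Num.sqrt t).
- move=> t; rewrite in_itv/= segE le_eqVlt => /andP[/predU1P[<- _|t0 t1]].
    by rewrite mul0r scale0r addr0.
  by have [] := segf t; rewrite ?t0.
- apply: continuous_subspaceT => t; apply: cvgMr; exact: sqrt_continuous.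
- move=> t; rewrite in_itv/= => /andP[t0 t1].
  exists (2 * Num.sqrt (C * k) * (2 * Num.sqrt t)^-1).
    by have := is_deriveZ (2 * Num.sqrt (C * k)) (is_derive1_sqrt t0).
  rewrite segE addrAC subrr add0r eucl_normZ n1' mulr1 gtr0_norm//.
  have t01 : 0 < t <= 1 by rewrite t0 ltW.
  have [_ fle] := segf t t01.
  apply: (@le_trans _ _ (Num.sqrt (C / (t * k)) * k)).
    by rewrite ler_wpM2r ?(ltW k0)// ler_wsqrtr.
  have -> : 2 * Num.sqrt (C * k) * (2 * Num.sqrt t)^-1 = Num.sqrt (C * k) / Num.sqrt t.
    by field; rewrite gt_eqF// sqrtr_gt0.
  have Ck0 : 0 <= C * k by rewrite ltW// mulr_gt0.
  have -> : C / (t * k) = k^-1 ^+ 2 * ((C * k) * t^-1).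
    by field; rewrite !gt_eqF.
  rewrite sqrtrM ?sqr_ge0// sqrtr_sqr gtr0_norm ?invr_gt0// mulrAC mulVf ?gt_eqF//.
  by rewrite mul1r sqrtrM// sqrtrV// ltW.
by split; [exists (seg w (w + k *: n))|move: le; rewrite sqrtr0 mulr0 subr0 sqrtr1 mulr1].
Qed.

(** The points are joined by three segments: away from the axis by [k], across at
    distance at least [k] from the axis, and back. *)
Lemma riem_dist_upper N w w' k : ray_compl w -> ray_compl w' ->
  eucl_norm w + 1 <= N -> eucl_norm w' + 1 <= N -> 0 < k <= 1 ->
  (exists c, joins w w' c) /\
  rho w w' <= 4 * Num.sqrt (conformal_bound N * k) +
              Num.sqrt (conformal_bound N / k) * eucl_norm (w' - w).
Proof.
move=> wr wr' wN wN' k01; have /andP[k0 k1] := k01.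
have [n [n0 n1 nw nw']] := exists_normal w w'.
have n1' : eucl_norm n = 1 by rewrite eucl_normE n1 sqrtr1.
have [[c1 j1] l1] := riem_dist_normal wr wN n0 n1 nw k01.
have [[c3 /(joins_opp alpha_gt1)[c3' j3 _]] l3] := riem_dist_normal wr' wN' n0 n1 nw' k01.
set a := w + k *: n in j1 l1; set b := w' + k *: n in j3 l3.
have ba : b - a = w' - w by rewrite /b /a opprD addrACA subrr addr0.
have segE t : seg a b t = (1 - t) *: w + t *: w' + k *: n.
  by rewrite /seg ba /a scalerBl scale1r scalerBr; apply/rowP => i; rewrite !mxE; ring.
have segf t : t \in `[0, 1] -> ray_compl (seg a b t) /\ f (seg a b t) <= conformal_bound N / k.
  rewrite in_itv/= => /andP[t0 t1]; rewrite segE.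
  apply: (@conformal_factor_normal N n) => //.
    rewrite !dotDr !dotZr n1 mulr1 lerDr.
    by rewrite addr_ge0// mulr_ge0 ?subr_ge0.
  apply: le_trans (eucl_normD _ _) _; rewrite eucl_normZ n1' mulr1 (gtr0_norm k0).
  have := eucl_normD ((1 - t) *: w) (t *: w').
  rewrite !eucl_normZ (ger0_norm t0) ger0_norm ?subr_ge0//; nra.
have [|||j2 l2] := @riem_dist_seg a b (fun t => Num.sqrt (conformal_bound N / k) * eucl_norm (w' - w) * t).
- by move=> t /segf[].
- by apply: continuous_subspaceT => t; exact: cvgMr.
- move=> t t01; exists (Num.sqrt (conformal_bound N / k) * eucl_norm (w' - w)).
    have := is_deriveZ (Num.sqrt (conformal_bound N / k) * eucl_norm (w' - w)) (is_derive_id t 1).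
    by rewrite [_ *: 1]mulr1.
  rewrite ba ler_wpM2r ?eucl_norm_ge0// ler_wsqrtr//.
  by have [] := segf t (subset_itv_oo_cc t01).
have [c12 j12 _] := joins_cat alpha_gt1 j1 j2.
have [c13 j13 _] := joins_cat alpha_gt1 j12 j3.
split; first by exists c13.
have := riem_dist_triangle_path alpha_gt1 j1 j2.
have := riem_dist_triangle_path alpha_gt1 j12 j3.
have [c3'' j3'' _] := joins_opp alpha_gt1 j3.
have := riem_dist_sym_le alpha_gt1 j3''.
move: l2; rewrite mulr0 subr0 mulr1; lra.
Qed.

Lemma joins_exists w w' : ray_compl w -> ray_compl w' -> exists c, joins w w' c.
Proof.
move=> wr wr'.
have [|||//] := @riem_dist_upper (Num.max (eucl_norm w) (eucl_norm w') + 1) w w' 1 wr wr'.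
- by rewrite lerD2r le_max lexx.
- by rewrite lerD2r le_max lexx orbT.
- by rewrite ltr01 lexx.
Qed.

Lemma riem_dist_sym w w' : ray_compl w -> ray_compl w' -> rho w w' = rho w' w.
Proof.
move=> wr wr'; have [c j] := joins_exists wr wr'; have [c' j'] := joins_exists wr' wr.
by apply/eqP; rewrite eq_le !(riem_dist_sym_le alpha_gt1 j) (riem_dist_sym_le alpha_gt1 j').
Qed.

Lemma riem_dist_triangle w p q : ray_compl p -> ray_compl w -> ray_compl q ->
  rho p q <= rho p w + rho w q.
Proof.
move=> pr wr qr; have [c j] := joins_exists pr wr; have [c' j'] := joins_exists wr qr.
exact: riem_dist_triangle_path j j'.
Qed.

(** First [k] is chosen small enough for the normal segments to be short, then the
    Euclidean distance small enough for the transversal one.  The bound is uniform up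
    to the axis, which makes the extension to the axis possible. *)
Lemma riem_dist_small N (e : R) : 0 < e -> exists2 d, 0 < d &
  forall w w', ray_compl w -> ray_compl w' -> eucl_norm w <= N -> eucl_norm w' <= N ->
    eucl_norm (w' - w) <= d -> rho w w' <= e.
Proof.
move=> e0; pose M := `|N| + 1.
have C0 : 0 < conformal_bound M by apply: conformal_bound_gt0; rewrite addr_ge0.
set C := conformal_bound M in C0.
pose k := Num.min 1 ((e / 8) ^+ 2 / C).
have k0 : 0 < k by rewrite lt_min ltr01 divr_gt0// exprn_gt0// divr_gt0.
have kC : 4 * Num.sqrt (C * k) <= e / 2.
  have : Num.sqrt (C * k) <= e / 8.
    rewrite -[leRHS]ger0_norm; last by rewrite divr_ge0// ltW.
    rewrite -sqrtr_sqr ler_wsqrtr// mulrC -ler_pdivlMr//.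
    by rewrite /k ge_min lexx orbT.
  lra.
have s0 : 0 < Num.sqrt (C / k) by rewrite sqrtr_gt0 divr_gt0.
exists (e / 2 / Num.sqrt (C / k)); first by rewrite !divr_gt0.
move=> w w' wr wr' wN wN'; rewrite ler_pdivlMr// mulrC => ww'.
have NM : N + 1 <= M by rewrite lerD2r ler_norm.
have [|||_ H] := @riem_dist_upper M w w' k wr wr'.
- by apply: le_trans NM; rewrite lerD2r.
- by apply: le_trans NM; rewrite lerD2r.
- by rewrite k0 ge_min lexx.
move: H; rewrite -/C; lra.
Qed.

End estimates.

(** * Symmetries and lower bounds of the Riemannian distance *)

Section symmetries.
Context {R : realType} (alpha : R) (alpha_gt1 : 1 < alpha).
Local Notation E3 := 'rV[R]_3.
Local Notation f := (@conformal_factor R alpha).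
Local Notation len := (riem_length alpha).
Local Notation rho := (riem_dist alpha).
Implicit Types (p q n w z : E3) (c : R -> E3) (t k : R).

Lemma dot_continuous n : continuous (dot n).
Proof.
move=> p; apply/(@cvgrPdist_le _ _ _ (nbhs p)) => e e0; apply/nbhs_euclP.
have n1 : 0 < eucl_norm n + 1 by rewrite ltr_wpDl ?eucl_norm_ge0.
exists (e / (eucl_norm n + 1)); first by rewrite divr_gt0.
move=> q; rewrite ltr_pdivlMr// => qp.
have n0 := eucl_norm_ge0 n; have qp0 := eucl_norm_ge0 (q - p).
have h1 := cauchy_schwarz n (p - q); have h2 := cauchy_schwarz n (q - p).
rewrite -dotBr ler_norml; rewrite -opprB dotNr in h2.
rewrite eucl_normN in h2; rewrite eucl_distC in qp qp0.
by apply/andP; split; nra.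
Qed.

(** A linear map that multiplies the speed of all curves by [k] turns arc-length
    functions into arc-length functions, up to the factor [k]. *)
Lemma riem_dist_similarity (phi : E3 -> E3) k p q : 0 < k ->
  (forall a (u v : E3), phi (a *: u + v) = a *: phi u + phi v) -> continuous phi ->
  (forall z, ray_compl z -> ray_compl (phi z)) ->
  (forall z v, ray_compl z ->
     Num.sqrt (f (phi z)) * eucl_norm (phi v) = k * (Num.sqrt (f z) * eucl_norm v)) ->
  ray_compl p -> ray_compl q -> rho (phi p) (phi q) <= k * rho p q.
Proof.
move=> k0 phil phic phir phif pr qr; have [c0 j0] := joins_exists alpha_gt1 pr qr.
rewrite -ler_pdivrMl//; apply: (riem_dist_ge j0) => c j.
rewrite ler_pdivrMl//.
have jphi : joins (phi p) (phi q) (phi \o c).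
  case: j => /piecewise_C1P cP cr cp cq; split => /=; rewrite ?cp ?cq//.
    by apply/piecewise_C1P; exact: piecewise_on_linear.
  by move=> t t01; exact/phir/cr.
have [S [L [cL ->]]] := admissible_arc_length alpha_gt1 (joins_admissible j).
apply: le_trans (riem_dist_le alpha_gt1 jphi) _.
rewrite (riem_lengthE alpha_gt1 (joins_admissible jphi) (S := S) (L := fun t => k * L t)).
  by rewrite mulrBr.
case: cL => cL dL; split.
  by move=> t; apply: cvgMr; exact: cL.
move=> t t01 tS; have [dc Lt] := dL t t01 tS.
have dphi : is_derive t 1 (phi \o c) (phi (derive1 c t)).
  by apply: is_derive_linear => //; rewrite derive1E; exact/derivableP.
split; first by have [] := dphi.
have -> : speed alpha (phi \o c) t = k * speed alpha c t.
  rewrite /speed derive1E (@derive_val _ _ _ _ _ _ _ dphi) phif//.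
  by case: j => _ + _ _; apply; exact: subset_itv_oo_cc.
exact: is_deriveZ.
Qed.

(** The exponent by which dilations scale lengths: [1] from the length of vectors and
    [(alpha^-1 - 1) / 2] from the square root of the conformal factor. *)
Definition dilation_exp : R := (1 + alpha^-1) / 2.

Lemma riem_distZ_le l p q : 0 < l -> ray_compl p -> ray_compl q ->
  rho (l *: p) (l *: q) <= l `^ dilation_exp * rho p q.
Proof.
move=> l0; apply: (riem_dist_similarity (phi := fun z => l *: z)).
- exact: powR_gt0.
- by move=> a u v; rewrite scalerDr !scalerA mulrC.
- by move=> z; exact: (cvgZr cvg_id).
- by move=> z; exact: ray_complZ.
move=> z v zr; rewrite conformal_factorZ// eucl_normZ gtr0_norm//.
rewrite sqrtrM ?powR_ge0// -powR12_sqrt ?powR_ge0// -powRrM.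
have -> : l `^ dilation_exp = l `^ ((alpha^-1 - 1) * 2^-1) * l.
  rewrite -[X in _ * X]powRr1 ?(ltW l0)// -powRD; last by rewrite (gt_eqF l0) implybT.
  by congr (_ `^ _); rewrite /dilation_exp; lra.
ring.
Qed.

Lemma riem_distZ l p q : 0 < l -> ray_compl p -> ray_compl q ->
  rho (l *: p) (l *: q) = l `^ dilation_exp * rho p q.
Proof.
move=> l0 pr qr; apply/eqP; rewrite eq_le riem_distZ_le//=.
have l1 : 0 < l^-1 by rewrite invr_gt0.
have := riem_distZ_le l1 (ray_complZ l0 pr) (ray_complZ l0 qr).
rewrite !scalerA mulVf ?gt_eqF// !scale1r.
have -> : l^-1 `^ dilation_exp = (l `^ dilation_exp)^-1.
  by rewrite -[l^-1]powR_inv1 ?(ltW l0)// -powRrM mulN1r powRN.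
by rewrite ler_pdivlMl ?powR_gt0.
Qed.

(** Reflections stand in for rotations: any two points with the same axial coordinate
    and the same distance to the axis are exchanged by one of them. *)
Definition reflection n p : E3 := p - (2 * dot n p) *: n.

Section reflection_theory.
Variables (n : E3) (n0 : n 0 0 = 0) (n1 : dot n n = 1).
Local Notation s := (reflection n).

Lemma reflection_linear a p q : s (a *: p + q) = a *: s p + s q.
Proof.
rewrite /reflection dotDr dotZr; apply/rowP => i; rewrite !mxE; ring.
Qed.

Lemma reflectionB p q : s (p - q) = s p - s q.
Proof. by rewrite addrC -scaleN1r reflection_linear scaleN1r addrC. Qed.

Lemma reflection_norm p : eucl_norm (s p) = eucl_norm p.
Proof.
rewrite !eucl_normE /reflection; congr Num.sqrt.
rewrite dotBl !dotBr !dotZl !dotZr n1 (dotC p n); ring.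
Qed.

Lemma reflection_axis t : s (axis_pt t) = axis_pt t.
Proof. by rewrite /reflection dotC dot_axis n0 !mulr0 scale0r subr0. Qed.

Lemma reflection_dist_axis p t :
  eucl_norm (s p - axis_pt t) = eucl_norm (p - axis_pt t).
Proof. by rewrite -{1}reflection_axis -reflectionB reflection_norm. Qed.

Lemma reflection_ray_compl p : ray_compl p -> ray_compl (s p).
Proof.
move=> pr; apply: dist_axis_ray_compl => t t0.
by rewrite reflection_dist_axis dist_axis_pos.
Qed.

Lemma reflectionK p : s (s p) = p.
Proof.
rewrite /reflection dotBr dotZr n1; apply/rowP => i; rewrite !mxE; ring.
Qed.

Lemma reflection_continuous : continuous s.
Proof.
move=> p; apply/(@cvgrPdist_lt _ _ _ (nbhs p)) => e e0; apply/nbhs_euclP.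
exists e => // q qp; apply: le_lt_trans (norm_le_eucl_norm _) _.
by rewrite -reflectionB reflection_norm eucl_distC.
Qed.

Lemma riem_dist_reflection p q : ray_compl p -> ray_compl q ->
  rho (s p) (s q) = rho p q.
Proof.
suff le p' q' : ray_compl p' -> ray_compl q' -> rho (s p') (s q') <= rho p' q'.
  move=> pr qr; apply/eqP; rewrite eq_le le//=.
  by have := le _ _ (reflection_ray_compl pr) (reflection_ray_compl qr); rewrite !reflectionK.
move=> pr qr; rewrite -[leRHS]mul1r; apply: riem_dist_similarity => //.
- exact: reflection_linear.
- exact: reflection_continuous.
- exact: reflection_ray_compl.
- move=> z v zr; rewrite mul1r reflection_norm.
  by rewrite (@eq_conformal_factor _ _ (s z) z)// => t; exact: reflection_dist_axis.
Qed.

End reflection_theory.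

(** Up to its first exit time [T] from the ball of radius [a] about [w], or up to
    [T = 1] if it stays in the ball, a curve runs where its speed is at least [k]
    times the Euclidean one.  Projecting it to the line through [w] and [c T], one
    compares its length with [k] times the Euclidean distance covered. *)
Lemma riem_dist_lower k a w w' : 0 <= k -> 0 < a ->
  (forall z, ray_compl z -> eucl_norm (z - w) <= a -> k ^+ 2 <= f z) ->
  ray_compl w -> ray_compl w' ->
  k * Num.min a (eucl_norm (w' - w)) <= rho w w'.
Proof.
move=> k0 a0 fk wr wr'; have [c0 j0] := joins_exists alpha_gt1 wr wr'.
apply: (riem_dist_ge j0) => c j; have adm := joins_admissible j.
case: j => cP cr cw cw'.
have cc := piecewise_C1_continuous cP.
have [S [L [cL ->]]] := admissible_arc_length alpha_gt1 adm.
suff [T [/andP[T0 T1] Tin Tout]] : exists T, [/\ 0 <= T <= 1,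
    forall t, t \in `]0, T[ -> eucl_norm (c t - w) <= a &
    Num.min a (eucl_norm (w' - w)) <= eucl_norm (c T - w)].
  apply: (@le_trans _ _ (k * eucl_norm (c T - w))); first exact: ler_wpM2l.
  apply: (@le_trans _ _ (L T - L 0)); last first.
    by rewrite lerD2r; apply: (arc_length_le cL).
  have [->|cTw] := eqVneq (c T - w) 0.
    by rewrite eucl_norm0 mulr0 subr_ge0; exact: (arc_length_le cL).
  have cT0 : 0 < eucl_norm (c T - w).
    rewrite lt_def eucl_norm_ge0 andbT; apply: contra cTw => /eqP/eucl_norm_eq0 ->.
    by [].
  pose n := (eucl_norm (c T - w))^-1 *: (c T - w).
  have n1 : eucl_norm n = 1.
    by rewrite eucl_normZ ger0_norm ?invr_ge0 ?eucl_norm_ge0// mulVf ?gt_eqF.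
  have <- : k * dot n (c T) - k * dot n (c 0) = k * eucl_norm (c T - w).
    rewrite -mulrBr -dotBr cw dotZl -sqr_eucl_norm expr2 mulrA mulVf ?mul1r//.
    by rewrite gt_eqF.
  have sub : `[0, T]%classic `<=` `[0, 1]%classic.
    by apply: subset_itv; rewrite bnd_simp.
  have [cL' dL] := cL.
  apply: (@derive_le_exc _ S (fun t => k * dot n (c t))) => //.
  - have /subspace_continuousP cc' := continuous_subspaceW sub cc.
    apply/subspace_continuousP => t tT; apply: cvgMr.
    exact: (cvg_comp _ _ (cc' t tT) (@dot_continuous n _)).
  - exact: continuous_subspaceW cL'.
  move=> t tT tS.
  have t01 : t \in `]0, 1[.
    by move: tT; rewrite !in_itv/= => /andP[-> tT]; exact: lt_le_trans tT T1.
  have [dc Lt] := dL t t01 tS.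
  exists (k * dot n (derive1 c t)), (speed alpha c t); split => //.
    apply: is_deriveZ.
    apply: (is_derive_linear (phi := dot n)).
    + by move=> x u v; rewrite dotDr dotZr.
    + exact: dot_continuous.
    + by rewrite derive1E; exact/derivableP.
  apply: (@le_trans _ _ (k * eucl_norm (derive1 c t))).
    by rewrite ler_wpM2l//; have := cauchy_schwarz n (derive1 c t); rewrite n1 mul1r.
  rewrite /speed ler_wpM2r ?eucl_norm_ge0// -[k]ger0_norm// -sqrtr_sqr ler_wsqrtr//.
  by apply: fk; [apply: cr; exact: subset_itv_oo_cc|exact: Tin].
(* clamping the parameter turns continuity within [0, 1] into plain continuity *)
pose h t := eucl_norm (c (Num.max 0 (Num.min t 1)) - w).
have clampE t : t \in `[0, 1] -> Num.max 0 (Num.min t 1) = t.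
  by rewrite in_itv/= => /andP[t0 t1]; rewrite min_l// max_r.
have clamp01 t : Num.max 0 (Num.min t 1) \in `[0, 1].
  by rewrite in_itv/= le_max lexx/= ge_max ler01 ge_min lexx orbT.
have ch : continuous h.
  move=> t; rewrite /h.
  have cm : Num.max 0 (Num.min s 1) @[s --> t] --> Num.max 0 (Num.min t 1).
    have c1 : {for t, continuous (fun s : R => Num.min s 1)}.
      exact: (@continuous_min R R id (fun=> 1) t cvg_id (@cvg_cst _ _ _ _ _)).
    exact: (@continuous_max R R (fun=> 0) (fun s => Num.min s 1) t (@cvg_cst _ _ _ _ _) c1).
  have cw1 : Num.max 0 (Num.min s 1) @[s --> t] -->
      within `[0, 1] (nbhs (Num.max 0 (Num.min t 1))).
    move=> P PP; have H := cm _ PP.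
    by apply: (@filterS _ (nbhs t) _ _ _ _ H) => s Ps; apply: Ps; exact: clamp01.
  have /subspace_continuousP cc' := cc.
  have h1 := cvg_comp _ _ cw1 (cc' _ (clamp01 t)).
  have h2 : c (Num.max 0 (Num.min s 1)) - w @[s --> t] -->
      c (Num.max 0 (Num.min t 1)) - w.
    by apply: cvgB; [exact: h1|exact: cvg_cst].
  exact: (cvg_comp _ _ h2 (@continuous_eucl_norm _ _)).
pose B := `[0, 1]%classic `&` h @^-1` [set x | a <= x].
have [B0|/set0P B0] := eqVneq B set0.
  exists 1; split; first by rewrite ler01 lexx.
    move=> t /subset_itv_oo_cc t01; rewrite leNgt; apply/negP => at_.
    have : B t by split => //=; rewrite /h clampE// ltW.
    by rewrite B0.
  by rewrite cw' ge_min lexx orbT.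
have cB : compact B.
  apply: (subclosed_compact _ (@segment_compact R 0 1)); last by move=> t [].
  apply: closedI; first exact: interval_closed.
  by apply: closed_comp; [move=> t _; exact: ch|exact: closed_ge].
have [T /set_mem[T01 hT] TB] := compact_EVT_min B0 cB (continuous_subspaceT (fun x => @cvg_id _ (nbhs x))).
exists T; split => //.
  move=> t; rewrite in_itv/= => /andP[t0 tT]; rewrite leNgt; apply/negP => at_.
  have t01 : t \in `[0, 1].
    by move: T01; rewrite /= !in_itv/= (ltW t0) => /andP[_]; exact/le_trans/ltW.
  have : T <= t by apply: TB; rewrite inE; split => //=; rewrite /h clampE// ltW.
  by rewrite leNgt tT.
by rewrite /= /h clampE// in hT; rewrite ge_min hT.
Qed.

End symmetries.

(** * The completed distance *)

Section completed.
Context {R : realType} (alpha : R) (alpha_gt1 : 1 < alpha).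
Local Notation E3 := 'rV[R]_3.
Local Notation f := (@conformal_factor R alpha).
Local Notation rho := (riem_dist alpha).
Local Notation d := (d0oo alpha).
Implicit Types (p q r n w z : E3) (t k e N : R).

(** Push [p] away from the line in the second coordinate, in the direction of the sign
    of that coordinate. *)
Lemma ray_compl_dense p e : 0 < e ->
  exists2 w, ray_compl w & eucl_norm (w - p) < e.
Proof.
move=> e0.
have [s [s0 sp]] : exists s, `|s| = e / 2 /\ p 0 1 + s != 0.
  have e2 : 0 < e / 2 by rewrite divr_gt0.
  have [p0|p0] := leP 0 (p 0 1).
    by exists (e / 2); rewrite gtr0_norm// gt_eqF// ltr_wpDl.
  by exists (- (e / 2)); rewrite normrN gtr0_norm//; split=> //; rewrite lt_eqF//; lra.
exists (p + s *: delta_mx 0 1).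
  apply: axial_ray_compl; rewrite axial_sqE !mxE /= mulr1 mulr0 addr0.
  by rewrite ltr_pwDl ?sqr_ge0// lt_def sqr_ge0 sqrf_eq0 sp.
rewrite addrAC subrr add0r eucl_normZ eucl_normE dot_delta mxE /= sqrtr1 mulr1 s0.
by rewrite ltr_pdivrMr//; lra.
Qed.

Lemma riem_dist_oscillation p q e : 0 < e -> exists2 x, 0 < x &
  forall w1 w2 w1' w2', ray_compl w1 -> ray_compl w2 -> ray_compl w1' -> ray_compl w2' ->
    eucl_norm (w1 - p) < x -> eucl_norm (w2 - q) < x ->
    eucl_norm (w1' - p) < x -> eucl_norm (w2' - q) < x ->
    `|rho w1 w2 - rho w1' w2'| <= e.
Proof.
move=> e0; pose N := Num.max (eucl_norm p) (eucl_norm q) + 1.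
have e2 : 0 < e / 2 by rewrite divr_gt0.
have [y y0 yP] := riem_dist_small alpha_gt1 N e2.
exists (Num.min 1 (y / 2)); first by rewrite lt_min ltr01 divr_gt0.
have small c w w' : eucl_norm c + 1 <= N -> ray_compl w -> ray_compl w' ->
    eucl_norm (w - c) < Num.min 1 (y / 2) -> eucl_norm (w' - c) < Num.min 1 (y / 2) ->
    rho w w' <= e / 2.
  move=> cN wr wr'; rewrite !lt_min => /andP[w1 wy] /andP[w1' wy'].
  apply: yP => //.
  - by apply: le_trans (eucl_norm_subr w c) _; lra.
  - by apply: le_trans (eucl_norm_subr w' c) _; lra.
  - by apply: le_trans (eucl_distD c _ _) _; rewrite (eucl_distC c); lra.
move=> w1 w2 w1' w2' r1 r2 r1' r2' d1 d2 d1' d2'.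
have pN : eucl_norm p + 1 <= N by rewrite lerD2r le_max lexx.
have qN : eucl_norm q + 1 <= N by rewrite lerD2r le_max lexx orbT.
have H1 := small _ _ _ pN r1 r1' d1 d1'; have H2 := small _ _ _ qN r2 r2' d2 d2'.
have T1 := riem_dist_triangle alpha_gt1 r1 r1' r2.
have T2 := riem_dist_triangle alpha_gt1 r1' r2' r2.
have T3 := riem_dist_triangle alpha_gt1 r1' r1 r2'.
have T4 := riem_dist_triangle alpha_gt1 r1 r2 r2'.
rewrite (riem_dist_sym alpha_gt1 r1' r1) in T3.
rewrite (riem_dist_sym alpha_gt1 r2' r2) in T2.
by rewrite ler_norml; apply/andP; split; lra.
Qed.

Let approach p q : set_system (E3 * E3) :=
  within (ray_compl `*` ray_compl) (nbhs (p, q)).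

Let approachP p q e : 0 < e ->
  approach p q [set w | [/\ ray_compl w.1, ray_compl w.2,
    eucl_norm (w.1 - p) < e & eucl_norm (w.2 - q) < e]].
Proof.
move=> e0; exists ([set w | eucl_norm (w - p) < e], [set w | eucl_norm (w - q) < e]).
  by split; apply/nbhs_euclP; exists e.
by move=> [w1 w2] /= [h1 h2] [r1 r2]; split.
Qed.

Let approach_proper p q : ProperFilter (approach p q).
Proof.
split; last exact: within_filter.
move=> [[A B] /= [/nbhs_euclP[a a0 aA] /nbhs_euclP[b b0 bB]] AB].
have [w1 r1 d1] := ray_compl_dense p a0; have [w2 r2 d2] := ray_compl_dense q b0.
exact: (AB (w1, w2) (conj (aA _ d1) (bB _ d2)) (conj r1 r2)).
Qed.

(** The limit that defines [d0oo] exists by completeness of the real numbers, the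
    oscillation being controlled by [riem_dist_oscillation]. *)
Lemma riem_dist_cvg p q : rho w.1 w.2 @[w --> approach p q] --> d p q.
Proof.
have pF := approach_proper p q.
suff /cvg_ex[l lP] : cvg (rho w.1 w.2 @[w --> approach p q]).
  by rewrite /d0oo (cvg_lim _ lP).
apply: cauchy_cvg; apply/cauchyP => e e0.
have e2 : 0 < e / 2 by rewrite divr_gt0.
have [x x0 xP] := riem_dist_oscillation p q e2.
have [w1 r1 d1] := ray_compl_dense p x0; have [w2 r2 d2] := ray_compl_dense q x0.
exists (rho w1 w2); apply: filterS (approachP p q x0) => -[w1' w2'] /= [r1' r2' d1' d2'].
rewrite /ball/=; apply: (@le_lt_trans _ _ (e / 2)); first exact: xP.
by rewrite ltr_pdivrMr//; lra.
Qed.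

(** All the properties of the completed distance are read off [riem_dist] at nearby
    points of [ray_compl]. *)
Lemma d0oo_approx p q e : 0 < e -> exists2 x, 0 < x &
  forall w1 w2, ray_compl w1 -> ray_compl w2 ->
    eucl_norm (w1 - p) < x -> eucl_norm (w2 - q) < x ->
    `|rho w1 w2 - d p q| <= e.
Proof.
move=> e0; have pF := approach_proper p q.
have e2 : 0 < e / 2 by rewrite divr_gt0.
have [x x0 xP] := riem_dist_oscillation p q e2.
exists x => // w1 w2 r1 r2 d1 d2.
have /cvgrPdist_le/(_ _ e2) H := @riem_dist_cvg p q.
have [[w1' w2'] [/= [r1' r2' d1' d2'] le]] := filter_ex (filterI (approachP p q x0) H).
have := xP w1 w2 w1' w2' r1 r2 r1' r2' d1 d2 d1' d2'.
move: le; rewrite /= !ler_norml => /andP[? ?] /andP[? ?]; apply/andP; split; lra.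
Qed.

Lemma d0oo_sym p q : d p q = d q p.
Proof.
suff le p' q' : d p' q' <= d q' p' by apply/eqP; rewrite eq_le !le.
apply/ler_addgt0Pr => e e0; have e2 : 0 < e / 2 by rewrite divr_gt0.
have [x x0 xP] := d0oo_approx p' q' e2; have [y y0 yP] := d0oo_approx q' p' e2.
have z0 : 0 < Num.min x y by rewrite lt_min x0.
have [w wr] := ray_compl_dense p' z0; rewrite lt_min => /andP[wx wy].
have [w' wr'] := ray_compl_dense q' z0; rewrite lt_min => /andP[wx' wy'].
have := xP w w' wr wr' wx wx'; have := yP w' w wr' wr wy' wy.
rewrite (riem_dist_sym alpha_gt1 wr wr') !ler_norml => /andP[? ?] /andP[? ?]; lra.
Qed.

Let approx_triangle (a b c a' b' c' e : R) : c <= a + b ->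
  `|a - a'| <= e / 3 -> `|b - b'| <= e / 3 -> `|c - c'| <= e / 3 ->
  c' <= a' + b' + e.
Proof. by rewrite !ler_norml => ? /andP[? ?] /andP[? ?] /andP[? ?]; lra. Qed.

Lemma d0oo_triangle q p r : d p r <= d p q + d q r.
Proof.
apply/ler_addgt0Pr => e e0; have e3 : 0 < e / 3 by rewrite divr_gt0.
have [x x0 xP] := d0oo_approx p q e3; have [y y0 yP] := d0oo_approx q r e3.
have [z z0 zP] := d0oo_approx p r e3.
have m0 : 0 < Num.min x (Num.min y z) by rewrite !lt_min x0 y0.
have [w1 r1] := ray_compl_dense p m0; rewrite !lt_min => /and3P[x1 y1 z1].
have [w2 r2] := ray_compl_dense q m0; rewrite !lt_min => /and3P[x2 y2 z2].
have [w3 r3] := ray_compl_dense r m0; rewrite !lt_min => /and3P[x3 y3 z3].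
exact: approx_triangle (riem_dist_triangle alpha_gt1 r1 r2 r3)
  (xP _ _ r1 r2 x1 x2) (yP _ _ r2 r3 y2 y3) (zP _ _ r1 r3 z1 z3).
Qed.

Lemma d0oo_ge0 p q : 0 <= d p q.
Proof.
apply/ler_addgt0Pr => e e0; have [x x0 xP] := d0oo_approx p q e0.
have [w1 r1 x1] := ray_compl_dense p x0; have [w2 r2 x2] := ray_compl_dense q x0.
have := xP w1 w2 r1 r2 x1 x2; have := riem_dist_ge0 alpha_gt1 w1 w2.
rewrite ler_norml => ? /andP[? ?]; lra.
Qed.

Lemma d0oo_small N e : 0 < e -> exists2 x, 0 < x & forall p q,
  eucl_norm p <= N -> eucl_norm q <= N -> eucl_norm (p - q) <= x -> d p q <= e.
Proof.
move=> e0; have e2 : 0 < e / 2 by rewrite divr_gt0.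
have [x x0 xP] := riem_dist_small alpha_gt1 (N + 1) e2.
exists (x / 3); first by rewrite divr_gt0.
move=> p q pN qN pq; have [y y0 yP] := d0oo_approx p q e2.
have m0 : 0 < Num.min y (Num.min 1 (x / 3)) by rewrite !lt_min y0 ltr01 divr_gt0.
have [w1 r1] := ray_compl_dense p m0; rewrite !lt_min => /and3P[y1 o1 x1].
have [w2 r2] := ray_compl_dense q m0; rewrite !lt_min => /and3P[y2 o2 x2].
have := yP w1 w2 r1 r2 y1 y2; rewrite ler_norml => /andP[? ?].
suff : rho w1 w2 <= e / 2 by lra.
apply: xP => //.
- by have := eucl_norm_subr w1 p; lra.
- by have := eucl_norm_subr w2 q; lra.
- have := eucl_distD q w2 w1; have := eucl_distD p q w1.
  by rewrite (eucl_distC p w1) (eucl_distC q p); lra.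
Qed.

Lemma d0ooxx p : d p p = 0.
Proof.
apply/eqP; rewrite eq_le d0oo_ge0 andbT; apply/ler_addgt0Pr => e e0.
have [x x0 xP] := d0oo_small (eucl_norm p) e0.
by rewrite add0r xP// subrr eucl_norm0 ltW.
Qed.

(** Similarities of the Riemannian distance pass to the completion. *)
Lemma d0oo_map (phi : E3 -> E3) k p q :
  (forall z, ray_compl z -> ray_compl (phi z)) -> continuous phi ->
  (forall w w', ray_compl w -> ray_compl w' -> rho (phi w) (phi w') = k * rho w w') ->
  d (phi p) (phi q) = k * d p q.
Proof.
move=> phir phic phid; apply/eqP; rewrite -subr_eq0 -normr_eq0 eq_le normr_ge0 andbT.
apply/ler_addgt0Pr => e e0; rewrite add0r.
have e2 : 0 < e / 2 by rewrite divr_gt0.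
have k1 : 0 < `|k| + 1 by rewrite ltr_wpDl.
have ek : 0 < e / 2 / (`|k| + 1) by rewrite divr_gt0.
have [x x0 xP] := d0oo_approx (phi p) (phi q) e2; have [y y0 yP] := d0oo_approx p q ek.
have near_phi z : exists2 a, 0 < a & forall w, eucl_norm (w - z) < a ->
    eucl_norm (phi w - phi z) < x.
  have nx : nbhs (phi z) [set w | eucl_norm (w - phi z) < x].
    by apply/nbhs_euclP; exists x.
  exact: (nbhs_euclP _ _).1 (phic z _ nx).
have [a a0 aP] := near_phi p; have [b b0 bP] := near_phi q.
have m0 : 0 < Num.min y (Num.min a b) by rewrite !lt_min y0 a0.
have [w1 r1] := ray_compl_dense p m0; rewrite !lt_min => /and3P[y1 a1 b1].
have [w2 r2] := ray_compl_dense q m0; rewrite !lt_min => /and3P[y2 a2 b2].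
have := xP _ _ (phir _ r1) (phir _ r2) (aP _ a1) (bP _ b2).
have := yP _ _ r1 r2 y1 y2; rewrite phid// ler_pdivlMr// => H1 H2.
have -> : d (phi p) (phi q) - k * d p q =
  - (k * rho w1 w2 - d (phi p) (phi q)) + k * (rho w1 w2 - d p q) by ring.
apply: le_trans (ler_normD _ _) _; rewrite normrN normrM.
rewrite [leRHS]splitr; apply: lerD => //; apply: le_trans H1.
by rewrite mulrC ler_wpM2l// lerDl.
Qed.

Lemma d0ooZ l p q : 0 < l -> d (l *: p) (l *: q) = l `^ dilation_exp alpha * d p q.
Proof.
move=> l0; apply: (d0oo_map (phi := fun z => l *: z)).
- by move=> z; exact: ray_complZ.
- by move=> z; exact: (cvgZr cvg_id).
- by move=> w w' wr wr'; exact: riem_distZ.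
Qed.

Lemma d0oo_reflection n p q : n 0 0 = 0 -> dot n n = 1 ->
  d (reflection n p) (reflection n q) = d p q.
Proof.
move=> n0 n1; rewrite -[RHS]mul1r; apply: d0oo_map.
- by move=> z; exact: reflection_ray_compl.
- exact: reflection_continuous.
- by move=> w w' wr wr'; rewrite mul1r; exact: riem_dist_reflection.
Qed.

(** The radius is doubled so that the hypothesis also covers the balls of radius [a]
    about the approximating points. *)
Lemma d0oo_lower k a p q : 0 <= k -> 0 < a ->
  (forall z, ray_compl z -> eucl_norm (z - p) <= 2 * a -> k ^+ 2 <= f z) ->
  k * Num.min a (eucl_norm (q - p)) <= d p q.
Proof.
move=> k0 a0 fk; apply/ler_addgt0Pr => e e0.
have e2 : 0 < e / 2 by rewrite divr_gt0.
have k1 : 0 < k + 1 by rewrite ltr_wpDl.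
have [x x0 xP] := d0oo_approx p q e2.
have m0 : 0 < Num.min x (Num.min a (e / 4 / (k + 1))).
  by rewrite !lt_min x0 a0 !divr_gt0.
have [w1 r1] := ray_compl_dense p m0; rewrite !lt_min => /and3P[x1 a1 e1].
have [w2 r2] := ray_compl_dense q m0; rewrite !lt_min => /and3P[x2 a2 e2'].
have := xP w1 w2 r1 r2 x1 x2; rewrite ler_norml => /andP[? ?].
have := @riem_dist_lower _ _ alpha_gt1 k a w1 w2 k0 a0 _ r1 r2.
have fk' z : ray_compl z -> eucl_norm (z - w1) <= a -> k ^+ 2 <= f z.
  by move=> zr zw; apply: fk => //; have := eucl_distD w1 z p; lra.
move=> /(_ fk') H.
suff : k * Num.min a (eucl_norm (q - p)) <= k * Num.min a (eucl_norm (w2 - w1)) + e / 2 by lra.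
have : Num.min a (eucl_norm (q - p)) <= Num.min a (eucl_norm (w2 - w1)) + e / 2 / (k + 1).
  have : eucl_norm (q - p) <= eucl_norm (w2 - w1) + e / 2 / (k + 1).
    have := eucl_distD w2 q p; have := eucl_distD w1 w2 p; rewrite (eucl_distC q w2).
    have -> : e / 2 / (k + 1) = 2 * (e / 4 / (k + 1)) by field; rewrite gt_eqF.
    by move: e1 e2'; lra.
  have : 0 < e / 2 / (k + 1) by rewrite divr_gt0.
  by rewrite /Num.min; case: ifP; case: ifP; lra.
move: (Num.min a _) (Num.min a _) => u v uv.
have : k * (e / 2 / (k + 1)) <= e / 2.
  by rewrite mulrA ler_pdivrMr//; nra.
nra.
Qed.

(** On bounded sets the conformal factor is bounded below.  This makes [d] separate
    points and makes its Cauchy filters Cauchy for the Euclidean distance. *)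
Lemma d0oo_ge_eucl N : exists2 k, 0 < k &
  forall p q, eucl_norm p <= N -> k * Num.min 1 (eucl_norm (q - p)) <= d p q.
Proof.
pose M := `|N| + 2 + 1; have M0 : 0 < M by rewrite ltr_wpDl// addr_ge0.
exists (Num.sqrt M^-1); first by rewrite sqrtr_gt0 invr_gt0.
move=> p q pN; apply: d0oo_lower; rewrite ?sqrtr_ge0// => z zr zp.
rewrite sqr_sqrtr ?invr_ge0 ?(ltW M0)//; apply: conformal_factor_ge => //.
have := eucl_norm_subr z p; have := ler_norm N; lra.
Qed.

Lemma d0oo_eq0 p q : d p q = 0 -> p = q.
Proof.
have [k k0 kP] := d0oo_ge_eucl (eucl_norm p).
have := kP p q (lexx _) => + pq0; rewrite pq0 pmulr_rle0// => le.
apply/esym/eqP; rewrite -subr_eq0; apply/eqP/eucl_norm_eq0/eqP.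
rewrite eq_le eucl_norm_ge0 andbT; move: le; rewrite ge_min => /orP[|//].
by rewrite ler10.
Qed.

(** The bound on the unit sphere propagates by dilation.  It makes [d]-bounded sets
    bounded. *)
Lemma d0oo_growth : exists2 k, 0 < k &
  forall q, k * eucl_norm q `^ dilation_exp alpha <= d 0 q.
Proof.
have [k k0 kP] := d0oo_ge_eucl 0; exists k => // q.
have [q0|q0] := eqVneq (eucl_norm q) 0.
  rewrite (eucl_norm_eq0 q0) d0ooxx eucl_norm0 powR0 ?mulr0//.
  by rewrite gt_eqF// /dilation_exp divr_gt0// ltr_wpDr// invr_ge0 ltW// (lt_trans ltr01).
have qp : 0 < eucl_norm q by rewrite lt_def q0 eucl_norm_ge0.
pose u := (eucl_norm q)^-1 *: q.
have u1 : eucl_norm u = 1.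
  by rewrite eucl_normZ gtr0_norm ?invr_gt0// mulVf.
have -> : d 0 q = eucl_norm q `^ dilation_exp alpha * d 0 u.
  by rewrite -d0ooZ// scaler0 scalerA divff// scale1r.
rewrite mulrC ler_wpM2l ?powR_ge0//.
by have := kP 0 u; rewrite eucl_norm0 subr0 u1 minxx mulr1; apply.
Qed.

End completed.

(** * Rays *)

Section rays.
Context {R : realType} (X : Type) (d : X -> X -> R).
Hypothesis d_triangle : forall y x z, d x z <= d x y + d y z.
Hypothesis dxx : forall x, d x x = 0.

(** The partition of [0, t] by [s] shows that the ray realizes equality in the triangle
    inequality. *)
Lemma ray_dist (g : R -> X) (s t : R) : is_ray d g -> 0 <= s -> s <= t ->
  d (g s) (g t) = d (g 0) (g t) - d (g 0) (g s).
Proof.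
move=> [_ gl _]; rewrite le_eqVlt => /predU1P[<- _|s0].
  by rewrite dxx subr0.
rewrite le_eqVlt => /predU1P[<-|st]; first by rewrite dxx subrr.
have t0 := lt_trans s0 st.
apply/eqP; rewrite eq_le lerBlDl lerBrDl d_triangle andbT.
rewrite -lee_fin -(gl _ _ (lexx 0) t0); apply: ereal_sup_ubound.
exists [:: s; t]; first by split; rewrite /= ?s0 ?st.
by rewrite /= big_nat_recr//= big_nat1.
Qed.

End rays.

(** The contradiction is derived for an abstract distance [d] on the space, from the
    comparison [same_direction] of the distances of two points to the origin, and from
    the lower bound [steep] close to [axis_pt 1]. *)
Section no_extension.
Context {R : realType}.
Local Notation E3 := 'rV[R]_3.
Local Notation e1 := (axis_pt 1 : E3).
Variable d : E3 -> E3 -> R.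
Hypothesis d_ge0 : forall p q, 0 <= d p q.
Hypothesis d_sym : forall p q, d p q = d q p.
Hypothesis d_triangle : forall q p r, d p r <= d p q + d q r.
Hypothesis same_direction : forall (u v : E3) (M : R),
  2^-1 <= u 0 0 -> 2^-1 <= v 0 0 ->
  axial_sq u / u 0 0 ^+ 2 = axial_sq v / v 0 0 ^+ 2 -> d 0 u <= M ->
  d 0 v - d 0 u <= 2 * M * eucl_norm (v - u).

Lemma dist_diff_le p q r : `|d p q - d p r| <= d q r.
Proof.
have := d_triangle q p r; have := d_triangle r p q; rewrite (d_sym r q) ler_norml.
by move=> *; apply/andP; split; lra.
Qed.

Lemma dist_far (t : R) p q : 0 < t -> d 0 p <= t / 8 -> 4 * t <= d 0 q -> t <= d p q.
Proof. have := dist_diff_le q p 0; rewrite !(d_sym q) (d_sym p 0) ler_norml => /andP[]; lra. Qed.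

(** [G] is the minimizing curve, [h] the distance travelled, which differs little from
    the distance to the origin, and [tau] the distance from [axis_pt 1] at which the
    curve is observed.  That [tau] is fixed while [G 0] may approach the origin makes
    the error [tau / 8] harmless. *)
Lemma no_extension (M a tau : R) (G : R -> E3) (h : R -> R) (Tg : R) :
  0 < a -> a <= 4^-1 -> 1 <= M -> d 0 e1 + 1 <= M ->
  (forall p q : E3, eucl_norm (p - e1) <= a ->
     4 * M * Num.min a (eucl_norm (q - p)) <= d p q) ->
  0 < tau -> tau <= 1 -> tau <= M * a ->
  0 <= Tg -> G Tg = e1 ->
  h 0 = 0 -> tau <= h Tg -> h x @[x --> +oo] --> +oo ->
  (forall s t : R, 0 <= s -> s <= t -> d (G s) (G t) = h t - h s) ->
  (forall t : R, 0 <= t -> d (G t) (G s) @[s --> within `[0, +oo[ (nbhs t)] --> 0) ->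
  (forall t : R, 0 <= t -> h s @[s --> within `[0, +oo[ (nbhs t)] --> h t) ->
  (forall t : R, 0 <= t -> `|h t - d 0 (G t)| <= tau / 8) -> False.
Proof.
move=> a0 a4 M1 e1M steep tau0 tau1 tauM Tg0 GT h0 hTg hy dGh dGc hc hd.
pose K := 4 * M; have Kp : 0 < K by rewrite mulr_gt0// (lt_le_trans ltr01).
have tauK : tau <= K * a / 4 by have -> : K * a / 4 = M * a by rewrite /K; field.
have {}steep p q : eucl_norm (p - e1) <= a -> K * Num.min a (eucl_norm (q - p)) <= d p q.
  exact: steep.
have h_nd (s t : R) : 0 <= s -> s <= t -> h s <= h t.
  by move=> s0 st; rewrite -subr_ge0 -dGh// d_ge0.
have within_itv (F : R -> R) (s t : R) : 0 <= s ->
    (forall x : R, s <= x <= t -> F y @[y --> within `[0, +oo[ (nbhs x)] --> F x) ->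
    {within `[s, t], continuous F}.
  move=> s0 Fc; apply/subspace_continuousP => x /=; rewrite in_itv/= => xst.
  move=> P /(Fc x xst) H; apply: (@filterS _ (nbhs x) _ _ _ _ H) => y Hy yst.
  apply: Hy; move: yst; rewrite /= !in_itv/= andbT => /andP[sy _].
  exact: le_trans sy.
(* the curve is examined on [t1, t2], where it stays at distance at most tau from e1 *)
have [t1 /andP[t10 t1T] ht1] : exists2 t1 : R, 0 <= t1 <= Tg & h t1 = h Tg - tau.
  have [||t t01 ht] := @IVT R h 0 Tg (h Tg - tau) Tg0.
  - by apply: within_itv => // x /andP[x0 _]; exact: hc.
  - have p0 : 0 <= h Tg by exact: le_trans (ltW tau0) hTg.
    by rewrite h0 (min_l p0) (max_r p0); apply/andP; split; lra.
  - by exists t.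
have [t2 t2T ht2] : exists2 t2 : R, Tg <= t2 & h t2 = h Tg + tau.
  have /cvgryPge/(_ (h Tg + tau)) hy' := hy.
  have [T2 [T2Tg hT2]] := @filter_ex _ _ _ _ (filterI (nbhs_pinfty_ge (num_real Tg)) hy').
  rewrite /= in T2Tg hT2.
  have [||t tT ht] := @IVT R h Tg T2 (h Tg + tau) T2Tg.
  - by apply: within_itv => // x /andP[x0 _]; apply: hc; exact: le_trans x0.
  - have p0 : h Tg <= h T2 by lra.
    by rewrite (min_l p0) (max_r p0); apply/andP; split; lra.
  - by exists t => //; move: tT; rewrite in_itv/= => /andP[].
have t12 (t : R) : t1 <= t <= t2 -> 0 <= t by move=> /andP[+ _]; exact: le_trans.
have near_e1 (t : R) : t1 <= t <= t2 -> d e1 (G t) <= tau.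
  move=> /andP[tt1 tt2]; rewrite -GT; have [tT|Tt] := leP t Tg.
    rewrite d_sym dGh//; last exact: le_trans tt1.
    by have := h_nd _ _ t10 tt1; lra.
  by rewrite dGh// ?(ltW Tt)//; have := h_nd t t2; move=> /(_ (le_trans Tg0 (ltW Tt)) tt2); lra.
have eucl_e1 (t : R) : t1 <= t <= t2 -> eucl_norm (G t - e1) <= a / 2.
  move=> /near_e1 le; have := steep e1 (G t).
  rewrite subrr eucl_norm0 => /(_ (ltW a0)) H.
  have : Num.min a (eucl_norm (G t - e1)) <= a / 4.
    by rewrite -(ler_pM2l Kp); lra.
  by rewrite ge_min => /orP[|]; lra.
have coord (t : R) : t1 <= t <= t2 -> 2^-1 <= G t 0 0.
  move=> /eucl_e1 H; have := coord_le_eucl_norm (G t - e1) 0.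
  by rewrite 2!mxE axis_ptE mulr1 ler_norml => /andP[]; lra.
have Gc (t : R) : t1 <= t <= t2 -> G s @[s --> within `[0, +oo[ (nbhs t)] --> G t.
  move=> tt; apply/cvgrPdist_lt => e e0.
  have m0 : 0 < K * Num.min a e by rewrite mulr_gt0// lt_min a0.
  have /cvgrPdist_lt/(_ _ m0) := dGc t (t12 _ tt); apply: filterS => s.
  rewrite sub0r normrN ger0_norm ?d_ge0// => H.
  apply: le_lt_trans (norm_le_eucl_norm _) _; rewrite eucl_distC.
  have ta : eucl_norm (G t - e1) <= a by have := eucl_e1 t tt; lra.
  have := le_lt_trans (steep _ (G s) ta) H; rewrite ltr_pM2l//.
  rewrite lt_min gt_min ltxx/= => /andP[Ga].
  by rewrite min_r// ltW.
(* the squared tangent of the angle with the axis, which vanishes at Tg *)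
pose kap t := axial_sq (G t) / (G t) 0 0 ^+ 2.
have kc (t : R) : t1 <= t <= t2 -> kap s @[s --> within `[0, +oo[ (nbhs t)] --> kap t.
  move=> tt.
  have cc i : G s 0 i @[s --> within `[0, +oo[ (nbhs t)] --> G t 0 i.
    exact: (cvg_comp _ _ (Gc t tt) (@coord_continuous R 1 3 0 i (G t))).
  have c2 i : (G s 0 i) ^+ 2 @[s --> within `[0, +oo[ (nbhs t)] --> (G t 0 i) ^+ 2.
    by rewrite expr2; apply: cvgM; exact: cc.
  apply: cvgM.
    have -> : (fun s => axial_sq (G s)) = (fun s => G s 0 1 ^+ 2 + G s 0 2%:R ^+ 2).
      by apply/funext => s; rewrite axial_sqE.
    by rewrite axial_sqE; apply: cvgD; exact: c2.
  apply: cvgV; last exact: c2.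
  by rewrite expf_neq0// gt_eqF//; have := coord t tt; lra.
have kT : kap Tg = 0.
  by rewrite /kap GT axial_sqE !axis_ptE /= !mulr0 expr0n /= addr0 mul0r.
have k0 (t : R) : 0 <= kap t by rewrite divr_ge0 ?axial_sq_ge0 ?sqr_ge0.
(* of t1 and t2, keep the one with the smaller angle, and find the same angle on the
   other side of Tg; the two points are then at distance at least tau *)
have [s [t [[s1 st t2'] kst taust]]] : exists s t : R,
    [/\ [/\ t1 <= s, s <= t & t <= t2], kap s = kap t & tau <= h t - h s].
  have [k12|k12] := leP (kap t1) (kap t2).
    have [||t /[!in_itv]/= /andP[Tt tt2] kt] := @IVT R kap Tg t2 (kap t1) t2T.
    - apply: within_itv => // x /andP[x1 x2]; apply: kc; rewrite x2 andbT.
      exact: le_trans x1.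
    - by rewrite kT (min_l (k0 _)) (max_r (k0 _)) k0.
    exists t1, t; split; [split => //; exact: le_trans Tt|by []|].
    by rewrite ht1; have := h_nd _ _ Tg0 Tt; lra.
  have [||s /[!in_itv]/= /andP[s1 sT] ks] := @IVT R kap t1 Tg (kap t2) t1T.
  - apply: within_itv => // x /andP[x1 x2]; apply: kc; rewrite x1/=.
    exact: le_trans t2T.
  - by rewrite kT (min_r (k0 _)) (max_l (k0 _)) k0 ltW.
  exists s, t2; split; [split => //; exact: le_trans t2T|by []|].
  by rewrite ht2; have := h_nd _ _ (le_trans t10 s1) sT; lra.
have sint : t1 <= s <= t2 by rewrite s1 (le_trans st).
have tint : t1 <= t <= t2 by rewrite t2' (le_trans s1).
have DM : d 0 (G s) <= M.
  by have := d_triangle e1 0 (G s); have := near_e1 s sint; lra.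
have H1 := same_direction (coord s sint) (coord t tint) kst DM.
have sa : eucl_norm (G s - e1) <= a by have := eucl_e1 s sint; lra.
have H2 := steep _ (G t) sa.
have H3 : eucl_norm (G t - G s) <= a.
  have := eucl_distD e1 (G t) (G s); rewrite (eucl_distC e1).
  by have := eucl_e1 s sint; have := eucl_e1 t tint; lra.
rewrite min_r// dGh// in H2; last exact: t12 sint.
have := hd s (t12 _ sint); have := hd t (t12 _ tint); rewrite !ler_norml.
move=> /andP[_ H4] /andP[H5 _].
move: H1 H2; rewrite /K -!mulrA; lra.
Qed.

End no_extension.

Section no_pole.
Context {R : realType} (alpha : R) (alpha_gt1 : 1 < alpha).
Local Notation E3 := 'rV[R]_3.
Local Notation f := (@conformal_factor R alpha).
Local Notation d := (d0oo alpha).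
Local Notation e1 := (axis_pt 1 : E3).
Implicit Types (p q r n w z u v : E3) (t k e N : R).

Lemma dilation_exp_gt0 : 0 < dilation_exp alpha.
Proof. by rewrite divr_gt0// ltr_wpDr// invr_ge0 ltW// (lt_trans ltr01). Qed.

Let dilation_exp_le1 : dilation_exp alpha <= 1.
Proof.
have : alpha^-1 <= 1 by rewrite invf_le1 ?ltW// (lt_trans ltr01).
rewrite /dilation_exp; lra.
Qed.

(** The reflection in the perpendicular bisector of [u] and [v] exchanges them and fixes
    the axis. *)
Lemma d0oo_rotation u v : u 0 0 = v 0 0 -> axial_sq u = axial_sq v ->
  d 0 u = d 0 v.
Proof.
move=> uv0 uvs; have [->//|uv] := eqVneq u v.
have nuv : dot u u = dot v v by move: uvs; rewrite /axial_sq uv0 => /addIr.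
have D0 : 0 < dot (u - v) (u - v).
  rewrite lt_def dot_ge0 andbT -sqr_eucl_norm sqrf_eq0.
  by apply: contra uv => /eqP/eucl_norm_eq0/eqP; rewrite subr_eq0.
pose n := (Num.sqrt (dot (u - v) (u - v)))^-1 *: (u - v).
have n0 : n 0 0 = 0 by rewrite !mxE uv0 subrr mulr0.
have n1 : dot n n = 1.
  by rewrite dotZl dotZr mulrA -expr2 exprVn sqr_sqrtr ?mulVf ?gt_eqF ?ltW.
rewrite -(d0oo_reflection alpha_gt1 0 u n0 n1).
have -> : reflection n 0 = 0.
  by rewrite -[X in reflection n X](subrr 0) reflectionB// subrr.
congr (d 0 _); rewrite /reflection dotZl scalerA.
set s := (Num.sqrt _)^-1; set x := dot (u - v) u.
have -> : 2 * (s * x) * s = 2 * x * s ^+ 2 by ring.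
rewrite exprVn sqr_sqrtr ?(ltW D0)// /x.
have -> : 2 * dot (u - v) u = dot (u - v) (u - v).
  by rewrite !dotBl !dotBr nuv (dotC v u); ring.
by rewrite divff ?gt_eqF// scale1r opprB addrC subrK.
Qed.

(** Since [u] and [v] make the same angle with the axis, [v] is a rotated copy of
    [l *: u] for the ratio [l] of their axial coordinates, so its distance to the origin
    is [l `^ dilation_exp] times that of [u]; and this power is at most [l] if [1 <= l],
    at most [1] otherwise. *)
Lemma d0oo_same_direction u v M : 2^-1 <= u 0 0 -> 2^-1 <= v 0 0 ->
  axial_sq u / u 0 0 ^+ 2 = axial_sq v / v 0 0 ^+ 2 -> d 0 u <= M ->
  d 0 v - d 0 u <= 2 * M * eucl_norm (v - u).
Proof.
move=> u2 v2 uv uM.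
have u0 : 0 < u 0 0 by apply: lt_le_trans u2; rewrite invr_gt0.
have v0 : 0 < v 0 0 by apply: lt_le_trans v2; rewrite invr_gt0.
pose l := v 0 0 / u 0 0; have l0 : 0 < l by rewrite divr_gt0.
have Du := d0oo_ge0 alpha_gt1 0 u.
have -> : d 0 v = l `^ dilation_exp alpha * d 0 u.
  rewrite -d0ooZ// scaler0; apply/esym/d0oo_rotation.
    by rewrite mxE /l divfK// gt_eqF.
  have -> : axial_sq (l *: u) = l ^+ 2 * axial_sq u.
    by rewrite /axial_sq dotZl dotZr mxE; ring.
  have un : u 0 0 ^+ 2 != 0 by rewrite expf_neq0// gt_eqF.
  have vn : v 0 0 ^+ 2 != 0 by rewrite expf_neq0// gt_eqF.
  move/eqP: uv; rewrite eqr_div// => /eqP uv.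
  have -> : l ^+ 2 * axial_sq u = axial_sq u * v 0 0 ^+ 2 / u 0 0 ^+ 2.
    by rewrite /l expr_div_n; ring.
  by rewrite uv mulfK.
have vu := coord_le_eucl_norm (v - u) 0; rewrite !mxE in vu.
have n0 := eucl_norm_ge0 (v - u).
have M0 : 0 <= M by exact: le_trans uM.
have [l1|l1] := leP l 1.
  have : l `^ dilation_exp alpha <= 1.
    have -> : 1 = 1 `^ dilation_exp alpha :> R by rewrite powR1.
    by rewrite ge0_ler_powR ?nnegrE ?(ltW dilation_exp_gt0) ?(ltW l0).
  have : 0 <= 2 * M * eucl_norm (v - u) by rewrite !mulr_ge0.
  nra.
have lb : l `^ dilation_exp alpha <= l by exact: ler1_powR (ltW l1) dilation_exp_le1.
have le : l - 1 <= 2 * eucl_norm (v - u).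
  have -> : l - 1 = (v 0 0 - u 0 0) / u 0 0 by rewrite mulrBl divff// gt_eqF.
  rewrite ler_pdivrMr//.
  by move: vu; rewrite ler_norml => /andP[_]; nra.
apply: (@le_trans _ _ ((l - 1) * d 0 u)); first nra.
apply: (@le_trans _ _ ((l - 1) * M)); first by rewrite ler_wpM2l// subr_ge0 ltW.
by rewrite mulrAC ler_wpM2r.
Qed.

(** This is where the unboundedness of the conformal factor on the axis enters. *)
Lemma d0oo_steep (K : R) : 0 <= K -> exists2 a, 0 < a <= 4^-1 &
  forall p q, eucl_norm (p - e1) <= a -> K * Num.min a (eucl_norm (q - p)) <= d p q.
Proof.
move=> K0; have [e e0 eP] := conformal_factor_blowup alpha_gt1 (K ^+ 2).
exists (Num.min 4^-1 (e / 3)).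
  by rewrite lt_min invr_gt0 ltr0n divr_gt0//= ge_min lexx.
set a := Num.min _ _ => p q pa.
have a0 : 0 < a by rewrite lt_min invr_gt0 ltr0n divr_gt0.
have ae : a <= e / 3 by rewrite ge_min lexx orbT.
apply: d0oo_lower => // z zr zp; apply: eP => //.
have := eucl_distD p z e1; lra.
Qed.

(** The multiple [l *: axis_pt 1] takes the place of [axis_pt 1]; dilating by [l^-1]
    reduces this to [no_extension], the starting point being then close to the origin
    as soon as [l] is large. *)
Lemma no_extension_past_axis : exists2 x, 0 < x & forall (g : R -> E3) (T : R),
  is_ray d g -> forall l, 0 < l -> 0 <= T -> g T = l *: e1 -> d 0 (l^-1 *: g 0) <= x -> False.
Proof.
pose M := d 0 e1 + 1; have M1 : 1 <= M by rewrite lerDr d0oo_ge0.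
have K0 : 0 <= 4 * M by rewrite mulr_ge0// (le_trans ler01).
have [a /andP[a0 a4] steep] := d0oo_steep K0.
have Ma0 : 0 < M * a by rewrite mulr_gt0// (lt_le_trans ltr01).
pose tau := Num.min 1 (M * a).
have tau0 : 0 < tau by rewrite lt_min ltr01.
have tau1 : tau <= 1 by rewrite ge_min lexx.
have tauM : tau <= M * a by rewrite ge_min lexx orbT.
have De1 : 4 * tau <= d 0 e1.
  have := steep e1 0; rewrite subrr eucl_norm0 sub0r eucl_normN eucl_norm_axis normr1.
  rewrite d0oo_sym// => /(_ (ltW a0)); rewrite min_l; lra.
clearbody tau; exists (tau / 8); first by rewrite divr_gt0.
move=> g Tg gray l l0 Tg0 gTg G0.
have linv : 0 < l^-1 by rewrite invr_gt0.
have GT : l^-1 *: g Tg = e1 by rewrite gTg scalerA mulVf ?scale1r// gt_eqF.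
have b0 : 0 < l^-1 `^ dilation_exp alpha by exact: powR_gt0.
have dG s t : d (l^-1 *: g s) (l^-1 *: g t) = l^-1 `^ dilation_exp alpha * d (g s) (g t).
  exact: d0ooZ.
move: (l^-1 `^ dilation_exp alpha) b0 dG => b b0 dG; have [gc _ gy] := gray.
apply: (@no_extension R d (d0oo_ge0 alpha_gt1) (d0oo_sym alpha_gt1)
  (d0oo_triangle alpha_gt1) d0oo_same_direction M a tau (fun t => l^-1 *: g t)
  (fun t => b * d (g 0) (g t)) Tg a0 a4 M1 (lexx _) steep tau0 tau1 tauM Tg0 GT).
- by rewrite d0ooxx// mulr0.
- rewrite -dG GT; apply: (dist_far (d0oo_sym alpha_gt1) (d0oo_triangle alpha_gt1) tau0 G0 De1).
- exact: gt0_cvgMry.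
- move=> s t s0 st; rewrite dG (ray_dist _ _ gray s0 st) ?mulrBr//.
  + exact: d0oo_triangle.
  + exact: d0ooxx.
- move=> t t0; have -> : (fun s => d (l^-1 *: g t) (l^-1 *: g s)) = (fun s => b * d (g t) (g s)).
    by apply/funext => s; rewrite dG.
  by rewrite -[X in _ --> X](mulr0 b); apply: cvgMr; exact: gc.
- move=> t t0; apply: cvgMr; apply/cvgrPdist_le => e e0.
  have /cvgrPdist_le/(_ _ e0) := gc t t0; apply: filterS => s.
  rewrite sub0r normrN ger0_norm ?d0oo_ge0// => H.
  exact: le_trans (dist_diff_le (d0oo_sym alpha_gt1) (d0oo_triangle alpha_gt1) _ _ _) H.
- move=> t t0; rewrite -dG; apply: le_trans G0; rewrite (d0oo_sym alpha_gt1 0 (_ *: g 0)).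
  rewrite (d0oo_sym alpha_gt1 _ (l^-1 *: g t)) (d0oo_sym alpha_gt1 0 (l^-1 *: g t)).
  exact: (dist_diff_le (d0oo_sym alpha_gt1) (d0oo_triangle alpha_gt1)).
Qed.

(** The ray from [q] to a point [l *: axis_pt 1] far out on the axis contradicts
    [no_extension_past_axis], because [l^-1 *: q] tends to the origin. *)
Theorem no_pole q : ~ pole d q.
Proof.
move=> qpole; have [x x0 xP] := no_extension_past_axis.
pose B := d 0 q / x + 1; have B0 : 0 < B by rewrite ltr_wpDl// divr_ge0 ?d0oo_ge0// ltW.
pose l := Num.max (eucl_norm q + 1) (B `^ (dilation_exp alpha)^-1).
have lq : eucl_norm q < l by rewrite lt_max ltrDl ltr01.
have l0 : 0 < l by exact: le_lt_trans (eucl_norm_ge0 _) lq.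
have lB : B <= l `^ dilation_exp alpha.
  have -> : B = (B `^ (dilation_exp alpha)^-1) `^ dilation_exp alpha.
    by rewrite -powRrM mulVf ?gt_eqF ?dilation_exp_gt0// powRr1// ltW.
  rewrite ge0_ler_powR ?nnegrE ?powR_ge0 ?(ltW dilation_exp_gt0) ?(ltW l0)//.
  by rewrite le_max lexx orbT.
have [|g [T [gray T0 g0 gT]]] := qpole (l *: e1).
  move=> lE; move: lq; rewrite -lE eucl_normZ eucl_norm_axis normr1 mulr1.
  by rewrite gtr0_norm// ltxx.
apply: (xP g T gray l l0 T0 gT); rewrite g0 -(scaler0 _ l^-1) d0ooZ ?invr_gt0//.
have -> : l^-1 `^ dilation_exp alpha = (l `^ dilation_exp alpha)^-1.
  by rewrite -[l^-1]powR_inv1 ?(ltW l0)// -powRrM mulN1r powRN.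
rewrite mulrC ler_pdivrMr ?powR_gt0//.
have : d 0 q <= x * B by rewrite /B mulrDr mulrC divfK ?gt_eqF// mulr1 lerDl ltW.
by move=> /le_trans; apply; rewrite ler_pM2l.
Qed.

End no_pole.

(** * Metric cones and self-similar spaces *)

Section cones.
Context {R : realType}.

(** Along an isometrically embedded half-line the sums that define the length of a
    curve telescope. *)
Lemma increasing_partition_sum (a b : R) (s : seq R) (F : R -> R -> R) :
  0 <= a -> (forall x y, 0 <= x -> x <= y -> F x y = y - x) -> itv_partition a b s ->
  \sum_(0 <= n < size s) F (nth b (a :: s) n) (nth b (a :: s) n.+1) = b - a.
Proof.
move=> + FE; elim: s a => [|x s IH] a a0 sP.
  by rewrite big_geq// (itv_partition_nil sP) subrr.
have [/= /andP[ax _] _] := sP.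
rewrite big_nat_recl//= FE ?(ltW ax)//.
rewrite (IH x (le_trans a0 (ltW ax)) (itv_partition_cons sP)); ring.
Qed.

Lemma isometric_ray (X : Type) (d : X -> X -> R) (g : R -> X) :
  (forall s t, 0 <= s -> 0 <= t -> d (g s) (g t) = `|s - t|) -> is_ray d g.
Proof.
move=> dg; split.
- move=> t t0; apply/cvgrPdist_lt => e e0.
  have H : nbhs t (fun s => `|t - s| < e).
    by exists e => // s; rewrite /ball_/=.
  apply: (@filterS _ (nbhs t) _ _ _ _ H) => s ts; rewrite /= in_itv/= andbT => s0.
  by rewrite sub0r normrN dg// normr_id.
- move=> a b a0 ab; have b0 := le_trans a0 (ltW ab).
  rewrite /curve_length dg// distrC gtr0_norm ?subr_gt0//.
  have sumE s : itv_partition a b s -> \sum_(0 <= n < size s)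
      d (g (nth b (a :: s) n)) (g (nth b (a :: s) n.+1)) = b - a.
    apply: (increasing_partition_sum (F := fun x y => d (g x) (g y)) a0) => x y x0 xy.
    by rewrite dg// ?(le_trans x0)// distrC ger0_norm ?subr_ge0.
  apply/eqP; rewrite eq_le; apply/andP; split.
    by apply: ub_ereal_sup => _ [s sP <-]; rewrite sumE.
  apply: ereal_sup_ubound; exists [:: b]; first exact: itv_partition1.
  by rewrite (sumE [:: b])//; exact: itv_partition1.
- apply/cvgryPge => A; near=> t.
  have t0 : 0 <= t by near: t; exact: nbhs_pinfty_ge.
  rewrite dg// sub0r normrN (ger0_norm t0).
  by near: t; apply: nbhs_pinfty_ge; exact: num_real.
Unshelve. all: by end_near. Qed.

(** The generator of the cone through [x], parametrized by the distance to the apex. *)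
Definition cone_ray (X : Type) (x : X) (t : R) : @cone R X :=
  match pselect (0 < t) with
  | left t0 => cone_pt (PosNum t0) x
  | right _ => @cone_apex R X
  end.

Lemma cone_ray_dist (X : metricType R) (x : X) (s t : R) : 0 <= s -> 0 <= t ->
  cone_dist (cone_ray x s) (cone_ray x t) = `|s - t|.
Proof.
move=> s0 t0; rewrite /cone_ray.
have npos (u : R) : 0 <= u -> ~ 0 < u -> u = 0.
  by move=> u0 /negP; rewrite -leNgt => u0'; apply/eqP; rewrite eq_le u0 u0'.
case: pselect => [sp|/(npos _ s0)->]; case: pselect => [tp|/(npos _ t0)->] /=.
- rewrite mdistxx min_l ?pi_ge0// cos0 mulr1 -sqrtr_sqr; congr Num.sqrt; ring.
- by rewrite subr0 ger0_norm.
- by rewrite sub0r normrN ger0_norm.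
- by rewrite subrr normr0.
Qed.

Lemma cone_apex_pole (Y : Type) (X : metricType R) (d : Y -> Y -> R)
    (f : cone X -> Y) : bijective f ->
  (forall u v, d (f u) (f v) = cone_dist u v) -> pole d (f (@cone_apex R X)).
Proof.
move=> [f' fK f'K] df y yapex.
case yE : (f' y) => [|r x]; first by case: yapex; rewrite -yE f'K.
exists (fun t => f (cone_ray x t)), r%:num; split => //.
- by apply: isometric_ray => s t s0 t0; rewrite df cone_ray_dist.
- by rewrite /cone_ray; case: pselect => // r0; exfalso; move: r0; rewrite ltxx.
- rewrite -[RHS]f'K yE /cone_ray; case: pselect => [r0|]; last by case; exact: gt0.
  by congr (f (cone_pt _ x)); apply/val_inj.
Qed.

End cones.

Section metric_space.
Context {R : realType} (alpha : R) (alpha_gt1 : 1 < alpha).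
Local Notation E3 := 'rV[R]_3.

(** [E3] already carries the metric of the sup norm, so the completed distance needs a
    type of its own. *)
Definition d0oo_space of 1 < alpha : Type := E3.
Local Notation Z := (d0oo_space alpha_gt1).

HB.instance Definition _ := Choice.copy Z E3.
HB.instance Definition _ := isMetric.Build R Z
  (d0ooxx alpha_gt1) (@d0oo_eq0 R alpha alpha_gt1) (d0oo_sym alpha_gt1)
  (d0oo_triangle alpha_gt1).

(** A [d]-Cauchy filter is concentrated on a bounded set, where it is Cauchy for the
    Euclidean distance, and its Euclidean limit is also a limit for [d]. *)
Lemma d0oo_cauchy_cvg (F : set_system E3) : ProperFilter F ->
  (forall e : R, 0 < e -> exists z, F [set y | d0oo alpha z y < e]) ->
  exists z, forall e : R, 0 < e -> F [set y | d0oo alpha z y < e].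
Proof.
move=> FF Fc.
have [z0 Fz0] := Fc 1 ltr01; have [k k0 grow] := d0oo_growth alpha_gt1.
pose b := dilation_exp alpha; have b0 : 0 < b := dilation_exp_gt0 alpha_gt1.
pose B := (d0oo alpha 0 z0 + 1) / k.
have B0 : 0 <= B by rewrite divr_ge0 ?(ltW k0)// addr_ge0// d0oo_ge0.
pose N := B `^ b^-1.
have bounded y : d0oo alpha z0 y < 1 -> eucl_norm y <= N.
  move=> zy; have yB : eucl_norm y `^ b <= B.
    rewrite ler_pdivlMr// mulrC; apply: le_trans (grow y) _.
    by apply: le_trans (d0oo_triangle alpha_gt1 z0 0 y) _; rewrite lerD2l ltW.
  have -> : eucl_norm y = (eucl_norm y `^ b) `^ b^-1.
    by rewrite -powRrM divff ?gt_eqF// powRr1// eucl_norm_ge0.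
  by rewrite ge0_ler_powR ?nnegrE ?powR_ge0 ?invr_ge0 ?(ltW b0).
have [m m0 mP] := d0oo_ge_eucl alpha_gt1 N.
have /cauchy_cvg/cvg_ex[z /= Fz] : cauchy F.
  apply/cauchyP => e e0.
  have e'0 : 0 < m * Num.min 1 e / 2 by rewrite divr_gt0// mulr_gt0// lt_min ltr01.
  have [z1 Fz1] := Fc _ e'0.
  have [y0 [z1y0 z0y0]] := filter_ex (filterI Fz1 Fz0); exists y0.
  apply: filterS Fz1 => y z1y; rewrite -ball_normE /ball_/=.
  apply: le_lt_trans (norm_le_eucl_norm _) _; rewrite eucl_distC.
  have : m * Num.min 1 (eucl_norm (y - y0)) < m * Num.min 1 e.
    apply: le_lt_trans (mP _ _ (bounded _ z0y0)) _.
    apply: le_lt_trans (d0oo_triangle alpha_gt1 z1 y0 y) _.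
    by rewrite (d0oo_sym alpha_gt1 y0) [ltRHS]splitr ltrD.
  rewrite ltr_pM2l// lt_min gt_min ltxx/= => /andP[y1].
  by rewrite min_r// ltW.
exists z => e e0; have e2 : 0 < e / 2 by rewrite divr_gt0.
have [x x0 xP] := d0oo_small alpha_gt1 (eucl_norm z + 1) e2.
have near_z : nbhs z [set y | eucl_norm (y - z) < Num.min 1 x].
  by apply/nbhs_euclP; exists (Num.min 1 x) => //; rewrite lt_min ltr01.
apply: filterS (Fz _ near_z) => y /=; rewrite lt_min => /andP[y1 yx].
apply: (@le_lt_trans _ _ (e / 2)); last by rewrite gtr_pMr// invf_lt1// ltr1n.
apply: xP.
- by rewrite lerDl.
- by apply: le_trans (eucl_norm_subr y z) _; rewrite lerD2l ltW.
- by rewrite eucl_distC ltW.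
Qed.

Lemma d0oo_space_complete : complete_space (Z : metricType R).
Proof.
move=> F FF Fc.
have [e e0|z Fz] := @d0oo_cauchy_cvg F FF.
  have /cauchyP/(_ e e0)[z Fz] := Fc; exists z.
  by apply: filterS Fz => y; rewrite ballEmdist.
exists z => P /nbhs_ballP[e e0 zP].
by apply: filterS (Fz e e0) => y zy; apply: zP; rewrite ballEmdist.
Qed.

(** The dilation by [l `^ dilation_exp^-1] is an isometry from the space rescaled by [l]
    onto the space itself. *)
Lemma d0oo_self_tangent :
  @tangent_cone R E3 (d0oo alpha) 0 Z (0 : E3).
Proof.
have b0 := dilation_exp_gt0 alpha_gt1.
pose l n : R := n.+1%:R; have l0 n : 0 < l n by rewrite ltr0n.
exists l; first split => //.
  apply/cvgryPge => A; near=> n; apply: (@le_trans _ _ n%:R); last by rewrite ler_nat.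
  by near: n; exact: nbhs_infty_ger.
split; first exact: d0oo_space_complete.
move=> r e r0 e0; near=> n.
pose c := l n `^ (dilation_exp alpha)^-1; have c0 : 0 < c by exact: powR_gt0.
have dc x y : d0oo alpha (c *: x) (c *: y) = l n * d0oo alpha x y.
  by rewrite d0ooZ// /c -powRrM mulVf ?gt_eqF// powRr1// ltW.
exists (fun x => c *: x); split.
- by rewrite scaler0.
- by move=> x y _ _; rewrite [mdist _ _]dc subrr normr0.
- move=> w zw; have cw : c *: (c^-1 *: w) = w by rewrite scalerA divff ?scale1r// gt_eqF.
  exists (c^-1 *: w); last by rewrite cw mdistxx.
  by rewrite -dc scaler0 cw; apply: lt_trans zw _; rewrite ltrBlDr ltrDl.
Unshelve. all: by end_near. Qed.

End metric_space.

Theorem proposition9p3 (R : realType) (alpha : R) (alpha_gt1 : 1 < alpha) :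
  ~ pole (d0oo alpha) (0 : 'rV[R]_3) /\
  ~ polar_space (d0oo alpha) /\ ~ is_metric_cone (d0oo alpha).
Proof.
split; first exact: no_pole; split.
  move=> /(_ _ _ (itc_first (d0oo_self_tangent alpha_gt1))).
  exact: no_pole.
move=> [X [f fbij fd]].
exact: (no_pole alpha_gt1 (cone_apex_pole fbij fd)).
Qed.
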